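(* Assume, as a standing hypothesis, that for edge/triangle constraints $(\varepsilon,\tau)$ near the point $(\tfrac12,\tfrac18)$ with $\tau<\varepsilon^3$ all entropy-maximizing graphons are bipodal. Then near $(\varepsilon,\tau)=(\tfrac12,\tfrac18)$, the boundary between the symmetric and asymmetric bipodal phases (the curve on which $\ddot S(\tfrac12)=0$, defined below) takes the form $$\tau=\varepsilon^3-8\left(\varepsilon-\tfrac12\right)^3+O\!\left(\left(\varepsilon-\tfrac12\right)^4\right).$$
   Context: Let $S_o(z)=-\tfrac12\,[z\ln z+(1-z)\ln(1-z)]$ for $0\le z\le 1$. A bipodal graphon with parameters $(a,b,c,d)\in[0,1]^4$ is the symmetric function $g:[0,1]^2\to[0,1]$ with $g(x,y)=a$ if $x,y<c$, $g(x,y)=b$ if $x,y>c$, and $g(x,y)=d$ if exactly one of $x,y$ is $<c$. Its edge density, triangle density and entropy are $\varepsilon=c^2a+2c(1-c)d+(1-c)^2b$, $\tau=c^3a^3+3c^2(1-c)ad^2+3c(1-c)^2bd^2+(1-c)^3b^3$, $S=c^2S_o(a)+(1-c)^2S_o(b)+2c(1-c)S_o(d)$. For fixed $(\varepsilon,\tau)$ with $\tau<\varepsilon^3$, the symmetric bipodal graphon has $c=\tfrac12$, $a=b=\varepsilon-(\varepsilon^3-\tau)^{1/3}$, $d=\varepsilon+(\varepsilon^3-\tau)^{1/3}$. Holding $(\varepsilon,\tau)$ fixed, let $c\mapsto(a(c),b(c),d(c))$ be the curve through this symmetric point along which, for each fixed $c$, $(a,b,d)$ is a constrained critical point of $S$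 subject to the two density constraints (equivalently, the vectors $\nabla_{(a,b,d)}\varepsilon$, $\nabla_{(a,b,d)}\tau$, $\nabla_{(a,b,d)}S$ are linearly dependent), and let $S(c)$ denote the entropy along this curve. The symmetric phase is the region where $\ddot S(\tfrac12)=\frac{d^2S}{dc^2}\big|_{c=1/2}<0$ and the asymmetric bipodal phase the region where it is $>0$; the boundary between them is the set of $(\varepsilon,\tau)$ where $\ddot S(\tfrac12)=0$. The point $(\tfrac12,\tfrac18)$ lies on the Erdős–Rényi curve $\tau=\varepsilon^3$. *)

(* Defs.v *)
From HB Require Import structures.
From mathcomp Require Import all_boot all_order all_algebra.
From mathcomp Require Import all_classical all_reals all_analysis.

Set Implicit Arguments.
Unset Strict Implicit.
Unset Printing Implicit Defensive.

Import Order.TTheory GRing.Theory Num.Theory.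
Import numFieldNormedType.Exports.

Local Open Scope classical_set_scope.
Local Open Scope ring_scope.

Section Graphons.
Variable R : realType.
Implicit Types (g h : R * R -> R) (a b c d e t z : R).

Local Notation mu := (@lebesgue_measure R).
Local Notation I := (`[0, 1]%classic : set R).

(* The library's convention ln 0 = 0 gives So 0 = So 1 = 0, as usual. *)
Definition So z : R := - 2^-1 * (z * ln z + (1 - z) * ln (1 - z)).

(* Graphons are functions on R * R of which only the values on the unit square
   matter. *)
Definition is_graphon g : Prop :=
  [/\ measurable_fun (I `*` I) g,
      forall x y, I x -> I y -> g (x, y) = g (y, x) &
      forall x y, I x -> I y -> 0 <= g (x, y) <= 1].

Definition edge_density g : R :=
  \int[mu]_(x in I) (\int[mu]_(y in I) g (x, y)).

Definition triangle_density g : R :=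
  \int[mu]_(x in I) (\int[mu]_(y in I) (\int[mu]_(z in I)
    (g (x, y) * g (y, z) * g (z, x)))).

Definition graphon_entropy g : R :=
  \int[mu]_(x in I) (\int[mu]_(y in I) So (g (x, y))).

Definition has_densities e t g : Prop :=
  edge_density g = e /\ triangle_density g = t.

Definition entropy_maximizing e t g : Prop :=
  [/\ is_graphon g, has_densities e t g &
      forall h, is_graphon h -> has_densities e t h ->
        graphon_entropy h <= graphon_entropy g].

(* The value on the lines x = c and y = c is immaterial (null set). *)
Definition bipodal_graphon a b c d (p : R * R) : R :=
  if p.1 < c then (if p.2 < c then a else d)
  else (if p.2 < c then d else b).

Definition measure_preserving (s : R -> R) : Prop :=
  [/\ measurable_fun I s,
      forall x, I x -> I (s x) &
      forall A : set R, measurable A -> A `<=` I ->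
        mu (I `&` s @^-1` A) = mu A].

(* Graphons are identified up to relabelling of [0, 1] and null sets; since
   all functionals above are invariant under relabelling, a maximizer can only
   be expected to be bipodal in this sense. *)
Definition is_bipodal g : Prop :=
  exists a b c d,
    [/\ I a, I b, I c & I d] /\
    exists s, measure_preserving s /\
      {ae (mu \x mu)%E, forall p, I p.1 -> I p.2 ->
        g p = bipodal_graphon a b c d (s p.1, s p.2)}.

(* Edge density, triangle density and entropy of [bipodal_graphon a b c d]. *)
Definition bip_edge a b c d : R :=
  c ^+ 2 * a + 2 * c * (1 - c) * d + (1 - c) ^+ 2 * b.

Definition bip_triangle a b c d : R :=
  c ^+ 3 * a ^+ 3 + 3 * c ^+ 2 * (1 - c) * a * d ^+ 2
  + 3 * c * (1 - c) ^+ 2 * b * d ^+ 2 + (1 - c) ^+ 3 * b ^+ 3.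

Definition bip_entropy a b c d : R :=
  c ^+ 2 * So a + (1 - c) ^+ 2 * So b + 2 * c * (1 - c) * So d.

(* Gradient in the variables (a, b, d), c being held fixed. *)
Definition grad_abd (F : R -> R -> R -> R -> R) a b c d : 'rV[R]_3 :=
  \row_(j < 3) nth 0 [:: derive1 (fun x => F x b c d) a;
                         derive1 (fun x => F a x c d) b;
                         derive1 (fun x => F a b c x) d] j.

Definition constrained_critical a b c d : Prop :=
  ~~ free [:: grad_abd bip_edge a b c d;
              grad_abd bip_triangle a b c d;
              grad_abd bip_entropy a b c d].

Definition sym_gap e t : R := (e ^+ 3 - t) `^ (3^-1).

Definition twice_derivable_near (f : R -> R) c : Prop :=
  \forall x \near c, derivable f x 1 /\ derivable (derive1 f) x 1.

(* [fa], [fb], [fd] give, for c near 1/2, the curve of constrained critical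
   points with densities (e, t) passing through the symmetric bipodal point. *)
Definition critical_curve e t (fa fb fd : R -> R) : Prop :=
  [/\ [/\ fa 2^-1 = e - sym_gap e t, fb 2^-1 = e - sym_gap e t &
          fd 2^-1 = e + sym_gap e t],
      [/\ twice_derivable_near fa 2^-1, twice_derivable_near fb 2^-1 &
          twice_derivable_near fd 2^-1] &
      \forall c \near (2^-1 : R),
        [/\ [/\ I (fa c), I (fb c) & I (fd c)],
            bip_edge (fa c) (fb c) c (fd c) = e,
            bip_triangle (fa c) (fb c) c (fd c) = t &
            constrained_critical (fa c) (fb c) c (fd c)]].

(* [v] is the second derivative at c = 1/2 of the entropy along the critical
   curve. The curve is locally unique, so [v] is determined by (e, t). *)
Definition entropy_ddot e t (v : R) : Prop :=
  exists fa fb fd, critical_curve e t fa fb fd /\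
    derive1n 2 (fun c => bip_entropy (fa c) (fb c) c (fd c)) 2^-1 = v.

(* The symmetric phase is where the second derivative is negative, the
   asymmetric bipodal phase where it is positive. *)
Definition phase_boundary e t : Prop := t < e ^+ 3 /\ entropy_ddot e t 0.

End Graphons.

(* Main.v *)
Require Import Defs.
From HB Require Import structures.
From mathcomp Require Import all_boot all_order all_algebra.
From mathcomp Require Import all_classical all_reals all_analysis.
From mathcomp Require Import ring lra.

Set Implicit Arguments.
Unset Strict Implicit.
Unset Printing Implicit Defensive.

Import Order.TTheory GRing.Theory Num.Theory.
Import numFieldNormedType.Exports.

Local Open Scope classical_set_scope.
Local Open Scope ring_scope.

(* Holding the edge density e fixed, a bipodal graphon is
   e + s (phi(x) + phi(y)) - mu phi(x) phi(y), with phi the two-valued function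
   orthonormal to 1, and its triangle density is e^3 - mu^3 + 3 (e - mu) s^2.
   At c = 1/2 the symmetric point is s = 0, mu = delta := (e^3 - tau)^(1/3).

   Differentiating the two constraints and the criticality condition twice
   along any critical curve gives the second derivative of the entropy as
   -4 (R3 - 2 delta R2^2 / W), where R3 and R2 are the second-order Taylor
   remainder of So and the first-order one of So' between e - delta and
   e + delta, and W > 0.  It is -32 delta^3 times a quantity ("bend") equal to
   -(8/3) (e - 1/2) + (4/3) delta up to second order and strictly increasing in
   delta > 0, whose zero is therefore unique, exists iff e > 1/2, and equals
   2 (e - 1/2) + O((e - 1/2)^2).

   Critical curves exist by the implicit function theorem, applied first to the
   triangle constraint and then to the criticality condition. *)

(** * Smooth functions of one and two variables *)

Section SmoothFunctions.
Variable R : realType.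
Implicit Types (f g u : R -> R) (F G : R * R -> R) (p q : R * R) (x l a b : R).

(** In the orthonormal family 1, phi the graphon is the matrix with rows (e, s) and (s, -mu), and
    its triangle density is the trace of the cube of that matrix. Since phi is orthogonal to 1, the
    edge constraint holds identically and only the triangle constraint is left to solve.
    [entropy_ddot] ranges over all twice differentiable critical curves, so one direction of the
    equivalence needs the value on an arbitrary curve and the other needs one curve. The value is
    read off second-order data at c = 1/2: these do not separate a'' from b'', but only a'' + b''
    enters the entropy, and the edge constraint gives it. The estimates are made in delta rather
    than tau, because the cube root is singular on the curve tau = e^3. There the second derivative
    of the entropy itself degenerates: R3 is O(delta^3) and delta R2^2 / W is O(delta^5). Only after
    division by delta^3 does a function with slope about 4/3 appear, whose zeros can be separated.
    All bounds use a single radius for e and delta, since the equivalence must hold on a full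
    neighbourhood of (1/2, 1/8). *)

Lemma near_continuous_lt (T : topologicalType) (f : T -> R) (t : T) (c : R) :
  {for t, continuous f} -> f t < c -> \forall s \near t, f s < c.
Proof. by move=> cf; apply: (cvgr_lt (f t) cf). Qed.

Lemma near_continuous_gt (T : topologicalType) (f : T -> R) (t : T) (c : R) :
  {for t, continuous f} -> c < f t -> \forall s \near t, c < f s.
Proof. by move=> cf; apply: (cvgr_gt (f t) cf). Qed.

Lemma near_dist_lt (x c r : R) : `|x - c| < r -> \forall z \near x, `|z - c| < r.
Proof.
move=> xr; apply: (@near_continuous_lt _ (fun z => `|z - c|)) => //.
by apply: cvg_norm; apply: cvgB; [exact: cvg_id | exact: cvg_cst].
Qed.

(** The factorization is assumed only near [x]. Replacing [g] by the difference quotient away from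
    [x] makes it global, and near [x] the two functions agree. *)
Lemma is_derive_near_caratheodory f g x :
  {for x, continuous g} ->
  (\forall z \near x, f z - f x = g z * (z - x)) -> is_derive x 1 f (g x).
Proof.
move=> cg fE; apply/is_derive1_caratheodory.
exists (fun z => if z == x then g x else (f z - f x) / (z - x)); split.
- move=> z; case: eqVneq => [->|zx]; first by rewrite !subrr mulr0.
  by rewrite divfK // subr_eq0.
- rewrite /prop_for /continuous_at eqxx; apply: cvg_trans cg; apply: near_eq_cvg.
  near=> z; case: eqVneq => [->//|zx].
  have -> : f z - f x = g z * (z - x) by near: z.
  by rewrite mulfK // subr_eq0.
- by rewrite eqxx.
Unshelve. all: by end_near. Qed.

Lemma derive_continuous f x l : is_derive x 1 f l -> {for x, continuous f}.
Proof. by move=> [df _]; exact/differentiable_continuous/derivable1_diffP. Qed.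

(* Total differentiability in Caratheodory's form: it composes by plain
   algebra, and dividing by the second slope gives implicit differentiation. *)
Definition cdiff F p (a b : R) : Prop :=
  exists P N, [/\ {for p, continuous P}, {for p, continuous N}, P p = a, N p = b
    & forall q, F q - F p = P q * (q.1 - p.1) + N q * (q.2 - p.2)].

Lemma cdiff_continuous F p a b : cdiff F p a b -> {for p, continuous F}.
Proof.
move=> [P [N [cP cN _ _ FE]]].
have -> : F = (fun q => F p + (P q * (q.1 - p.1) + N q * (q.2 - p.2))).
  by apply/funext => q; rewrite -FE addrC subrK.
rewrite /prop_for /continuous_at !subrr !mulr0 !addr0.
rewrite -[X in _ --> X]addr0 -[X in _ --> _ + X](addr0 0).
apply: cvgD; first exact: cvg_cst.
apply: cvgD.
  rewrite -(mulr0 (P p)) -(subrr p.1); apply: cvgM => //.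
  by apply: cvgB; [exact: cvg_fst | exact: cvg_cst].
rewrite -(mulr0 (N p)) -(subrr p.2); apply: cvgM => //.
by apply: cvgB; [exact: cvg_snd | exact: cvg_cst].
Qed.

Lemma cdiff_cst (c : R) p : cdiff (fun=> c) p 0 0.
Proof.
exists (fun=> 0), (fun=> 0); split=> //; try exact: cvg_cst.
by move=> q; rewrite subrr !mul0r addr0.
Qed.

Lemma cdiff_fst p : cdiff fst p 1 0.
Proof.
exists (fun=> 1), (fun=> 0); split=> //; try exact: cvg_cst.
by move=> q; rewrite mul0r addr0 mul1r.
Qed.

Lemma cdiff_snd p : cdiff snd p 0 1.
Proof.
exists (fun=> 0), (fun=> 1); split=> //; try exact: cvg_cst.
by move=> q; rewrite mul0r add0r mul1r.
Qed.

Lemma cdiffD F G p a b a' b' : cdiff F p a b -> cdiff G p a' b' ->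
  cdiff (fun q => F q + G q) p (a + a') (b + b').
Proof.
move=> [P [N [cP cN <- <- FE]]] [P' [N' [cP' cN' <- <- GE]]].
exists (fun q => P q + P' q), (fun q => N q + N' q); split=> //.
- exact: cvgD.
- exact: cvgD.
- by move=> q; have := FE q; have := GE q; lra.
Qed.

Lemma cdiffM F G p a b a' b' : cdiff F p a b -> cdiff G p a' b' ->
  cdiff (fun q => F q * G q) p (a * G p + F p * a') (b * G p + F p * b').
Proof.
move=> dF; have cF := cdiff_continuous dF.
case: dF => [P [N [cP cN <- <- FE]]] [P' [N' [cP' cN' <- <- GE]]].
exists (fun q => P q * G p + F q * P' q), (fun q => N q * G p + F q * N' q).
split=> //.
- by apply: cvgD; apply: cvgM => //; exact: cvg_cst.
- by apply: cvgD; apply: cvgM => //; exact: cvg_cst.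
- move=> q; have -> : F q * G q - F p * G p =
    (F q - F p) * G p + F q * (G q - G p) by ring.
  by rewrite FE GE; ring.
Qed.

Lemma cdiff_comp f F p l a b : is_derive (F p) 1 f l -> cdiff F p a b ->
  cdiff (fun q => f (F q)) p (l * a) (l * b).
Proof.
move=> /is_derive1_caratheodory[g [gE cg gl]] dF.
have cF := cdiff_continuous dF; case: dF => [P [N [cP cN <- <- FE]]].
have cgF : {for p, continuous (fun q => g (F q))}.
  by apply: (@continuous_comp _ _ _ F g).
exists (fun q => g (F q) * P q), (fun q => g (F q) * N q); rewrite gl; split=> //.
- exact: cvgM.
- exact: cvgM.
- by move=> q; rewrite gE FE; ring.
Qed.

Lemma continuous_pair f g x : {for x, continuous f} -> {for x, continuous g} ->
  {for x, continuous (fun z => (f z, g z))}.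
Proof. by move=> cf cg; apply: (cvg_pair cf cg). Qed.

Lemma cdiff_curve F u x l a b : cdiff F (x, u x) a b -> is_derive x 1 u l ->
  is_derive x 1 (fun z => F (z, u z)) (a + b * l).
Proof.
move=> [P [N [cP cN <- <- FE]]] du; have cu := derive_continuous du.
move: du => /is_derive1_caratheodory[g [gE cg <-]].
have cxu : {for x, continuous (fun z => (z, u z))}.
  by apply: continuous_pair => //; exact: cvg_id.
have cPu := @continuous_comp _ _ _ (fun z => (z, u z)) P x cxu cP.
have cNu := @continuous_comp _ _ _ (fun z => (z, u z)) N x cxu cN.
apply/is_derive1_caratheodory.
exists (fun z => P (z, u z) + N (z, u z) * g z); split=> //.
- by move=> z; rewrite FE /= gE; ring.
- by apply: cvgD => //; apply: cvgM.
Qed.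

Lemma cdiff_snd_derive F p a b : cdiff F p a b ->
  is_derive p.2 1 (fun z => F (p.1, z)) b.
Proof.
case: p => x y [P [N [_ cN _ <- FE]]] /=.
have cxu : {for y, continuous (fun z => (x, z))}.
  by apply: continuous_pair; [exact: cvg_cst | exact: cvg_id].
apply/is_derive1_caratheodory; exists (fun z => N (x, z)); split=> //.
- by move=> z; rewrite FE /= subrr mulr0 add0r.
- exact: (@continuous_comp _ _ _ (fun z => (x, z)) N).
Qed.

(** Class C^k near [x]. Derivatives are witnesses that need to be correct only near the point, so
    closed forms can be supplied. Continuity is asked on a neighbourhood because compositions and
    implicit functions are differentiated at all nearby points. *)
Fixpoint smooth1 k f x : Prop :=
  if k is k'.+1 then
    exists f' : R -> R, (\forall z \near x, is_derive (z : R) 1 f (f' z)) /\ smooth1 k' f' x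
  else \forall z \near x, {for z, continuous f}.

Fixpoint smooth2 k F p : Prop :=
  if k is k'.+1 then
    exists Fx Fy : R * R -> R, [/\ \forall q \near p, cdiff F q (Fx q) (Fy q),
      smooth2 k' Fx p & smooth2 k' Fy p]
  else \forall q \near p, {for q, continuous F}.

Lemma smooth1_0 f x : continuous f -> smooth1 0 f x.
Proof. by move=> cf; apply: (@nearW _ (nbhs x)). Qed.

Lemma smooth2_0 F p : continuous F -> smooth2 0 F p.
Proof. by move=> cF; apply: (@nearW _ (nbhs p)). Qed.

Lemma smooth1S k f x : smooth1 k.+1 f x -> smooth1 k f x.
Proof.
elim: k f => [|k IH] f [f' [df sf']] /=.
  by apply: filterS df => z; exact: derive_continuous.
by exists f'; split=> //; exact: IH.
Qed.

Lemma smooth2S k F p : smooth2 k.+1 F p -> smooth2 k F p.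
Proof.
elim: k F => [|k IH] F [Fx [Fy [dF sx sy]]] /=.
  by apply: filterS dF => z; exact: cdiff_continuous.
by exists Fx, Fy; split=> //; exact: IH.
Qed.

Lemma smooth2_le j k F p : (j <= k)%N -> smooth2 k F p -> smooth2 j F p.
Proof.
move=> /subnK <-; elim: (k - j)%N => [|n IH] //.
by rewrite addSn => /smooth2S/IH.
Qed.

Lemma smooth1_continuous k f x : smooth1 k f x -> {for x, continuous f}.
Proof.
elim: k f => [|k IH] f; first exact: nbhs_singleton.
by move/smooth1S; exact: IH.
Qed.

Lemma smooth2_continuous k F p : smooth2 k F p -> {for p, continuous F}.
Proof.
elim: k F => [|k IH] F; first exact: nbhs_singleton.
by move/smooth2S; exact: IH.
Qed.

Lemma smooth1_cst k (c : R) x : smooth1 k (fun=> c) x.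
Proof.
elim: k c => [|k IH] c; first by apply: smooth1_0; exact: cst_continuous.
by exists (fun=> 0); split=> //; apply: (@nearW _ (nbhs x)) => z; exact: is_derive_cst.
Qed.

Lemma smooth1_id k x : smooth1 k id x.
Proof.
case: k => [|k]; first by apply: smooth1_0 => z; exact: cvg_id.
exists (fun=> 1); split; last exact: smooth1_cst.
by apply: (@nearW _ (nbhs x)) => z; exact: is_derive_id.
Qed.

Lemma smooth1D k f g x : smooth1 k f x -> smooth1 k g x ->
  smooth1 k (fun z => f z + g z) x.
Proof.
elim: k f g => [|k IH] f g /=.
  by apply: filterS2 => z cf cg; exact: (cvgD cf cg).
move=> [f' [df sf]] [g' [dg sg]]; exists (fun z => f' z + g' z); split.
  by apply: filterS2 df dg => z; exact: is_deriveD.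
exact: IH.
Qed.

Lemma is_derive_mul f g x a b : is_derive x 1 f a -> is_derive x 1 g b ->
  is_derive x 1 (fun z => f z * g z) (a * g x + f x * b).
Proof.
move=> df dg; apply: is_derive_eq.
by rewrite /GRing.scale /=; ring.
Qed.

Lemma smooth1M k f g x : smooth1 k f x -> smooth1 k g x ->
  smooth1 k (fun z => f z * g z) x.
Proof.
elim: k f g => [|k IH] f g.
  by apply: filterS2 => z cf cg; exact: (cvgM cf cg).
move=> sf1 sg1; have sf := smooth1S sf1; have sg := smooth1S sg1.
case: sf1 sg1 => [f' [df sf']] [g' [dg sg']].
exists (fun z => f' z * g z + f z * g' z); split.
  by apply: filterS2 df dg => z; exact: is_derive_mul.
by apply: smooth1D; apply: IH.
Qed.

Lemma smooth1_comp k f g x : smooth1 k f (g x) -> smooth1 k g x ->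
  smooth1 k (fun z => f (g z)) x.
Proof.
elim: k f g => [|k IH] f g.
  move=> sf sg; have cg := smooth1_continuous (k := 0) sg.
  have /= := cg _ sf; move: sg; apply: filterS2 => z.
  by move=> cgz cfz; exact: (@continuous_comp _ _ _ g f).
move=> sf1 sg1; have sf := smooth1S sf1; have sg := smooth1S sg1.
have cg := smooth1_continuous sg1.
case: sf1 sg1 => [f' [df sf']] [g' [dg sg']].
exists (fun z => f' (g z) * g' z); split; last by apply: smooth1M => //; apply: IH.
have := cg _ df; move: dg; apply: filterS2 => z dg df'.
exact: (@is_derive1_comp _ f g).
Qed.

(** The derivative is a polynomial in the inverse itself, so the induction on [k] closes on a single
    function. *)
Lemma smooth1V k x : x != 0 -> smooth1 k GRing.inv x.
Proof.
move=> x0; have nz : \forall z \near x, z != 0.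
  by apply: (@cvgr_neq0 _ _ _ (nbhs x) _ id x) => //; exact: cvg_id.
elim: k => [|k IH] /=.
  by apply: filterS nz => z z0; exact: inv_continuous.
exists (fun z => -1 * (z^-1 * z^-1)); split.
  apply: filterS nz => z z0; apply: is_derive_eq.
    exact: (@is_deriveV _ id).
  by rewrite /GRing.scale /= mulr1 expr2 invfM mulN1r.
by apply: smooth1M; [exact: smooth1_cst | exact: smooth1M].
Qed.

Lemma smooth2_cst k (c : R) p : smooth2 k (fun=> c) p.
Proof.
elim: k c => [|k IH] c; first by apply: smooth2_0; exact: cst_continuous.
exists (fun=> 0), (fun=> 0); split=> //; apply: (@nearW _ (nbhs p)) => z; exact: cdiff_cst.
Qed.

Lemma smooth2_fst k p : smooth2 k fst p.
Proof.
case: k => [|k]; first by apply: smooth2_0 => q; exact: cvg_fst.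
exists (fun=> 1), (fun=> 0); split; try exact: smooth2_cst.
by apply: (@nearW _ (nbhs p)) => z; exact: cdiff_fst.
Qed.

Lemma smooth2_snd k p : smooth2 k snd p.
Proof.
case: k => [|k]; first by apply: smooth2_0 => q; exact: cvg_snd.
exists (fun=> 0), (fun=> 1); split; try exact: smooth2_cst.
by apply: (@nearW _ (nbhs p)) => z; exact: cdiff_snd.
Qed.

Lemma smooth2D k F G p : smooth2 k F p -> smooth2 k G p ->
  smooth2 k (fun q => F q + G q) p.
Proof.
elim: k F G => [|k IH] F G /=.
  by apply: filterS2 => z cF cG; exact: (cvgD cF cG).
move=> [Fx [Fy [dF sFx sFy]]] [Gx [Gy [dG sGx sGy]]].
exists (fun q => Fx q + Gx q), (fun q => Fy q + Gy q).
split; [|exact: IH|exact: IH].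
by apply: filterS2 dF dG => z; exact: cdiffD.
Qed.

Lemma smooth2M k F G p : smooth2 k F p -> smooth2 k G p ->
  smooth2 k (fun q => F q * G q) p.
Proof.
elim: k F G => [|k IH] F G.
  by apply: filterS2 => z cF cG; exact: (cvgM cF cG).
move=> sF1 sG1; have sF := smooth2S sF1; have sG := smooth2S sG1.
case: sF1 sG1 => [Fx [Fy [dF sFx sFy]]] [Gx [Gy [dG sGx sGy]]].
exists (fun q => Fx q * G q + F q * Gx q), (fun q => Fy q * G q + F q * Gy q).
split; [|by apply: smooth2D; apply: IH|by apply: smooth2D; apply: IH].
by apply: filterS2 dF dG => z; exact: cdiffM.
Qed.

Lemma smooth2_comp k f F p : smooth1 k f (F p) -> smooth2 k F p ->
  smooth2 k (fun q => f (F q)) p.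
Proof.
elim: k f F => [|k IH] f F.
  move=> sf sF; have cF := smooth2_continuous (k := 0) sF.
  have /= := cF _ sf; move: sF; apply: filterS2 => z.
  by move=> cFz cfz; exact: (@continuous_comp _ _ _ F f).
move=> sf1 sF1; have sf := smooth1S sf1; have sF := smooth2S sF1.
have cF := smooth2_continuous sF1.
case: sf1 sF1 => [f' [df sf']] [Fx [Fy [dF sFx sFy]]].
exists (fun q => f' (F q) * Fx q), (fun q => f' (F q) * Fy q).
split; [|by apply: smooth2M => //; apply: IH|by apply: smooth2M => //; apply: IH].
have := cF _ df; move: dF; apply: filterS2 => z dF df'.
exact: cdiff_comp.
Qed.

(** Applied to the quotient [-Fx / Fy], this is what lets an implicit function gain one order of
    smoothness at a time. *)
Lemma smooth_curve k F u x : smooth2 k F (x, u x) -> smooth1 k u x ->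
  smooth1 k (fun z => F (z, u z)) x.
Proof.
elim: k F => [|k IH] F.
  move=> sF su; have cu := smooth1_continuous (k := 0) su.
  have cxu : {for x, continuous (fun z => (z, u z))}.
  by apply: continuous_pair => //; exact: cvg_id.
  have /= := cxu _ sF; move: su; apply: filterS2 => z cuz cFz.
  apply: (@continuous_comp _ _ _ (fun z => (z, u z)) F) => //.
  by apply: continuous_pair => //; exact: cvg_id.
move=> [Fx [Fy [dF sFx sFy]]] su1; have su := smooth1S su1.
have cu := smooth1_continuous su1.
have cxu : {for x, continuous (fun z => (z, u z))}.
  by apply: continuous_pair => //; exact: cvg_id.
case: su1 => [u' [du su']].
exists (fun z => Fx (z, u z) + Fy (z, u z) * u' z); split.
  have /= := cxu _ dF; move: du; apply: filterS2 => z duz dFz.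
  exact: cdiff_curve.
by apply: smooth1D; [exact: IH | apply: smooth1M => //; exact: IH].
Qed.

End SmoothFunctions.

(** * The implicit function theorem for one equation *)

Section ImplicitFunction.
Variable R : realType.
Implicit Types (f g u : R -> R) (F G : R * R -> R) (p q : R * R) (x l a b : R).

Lemma is_derive_incr f (f' : R -> R) (a b : R) :
  (forall z, a <= z <= b -> is_derive z 1 f (f' z)) ->
  (forall z, a <= z <= b -> 0 < f' z) -> a < b -> f a < f b.
Proof.
move=> df f'0 ab.
have df' z : z \in `]a, b[ -> is_derive z 1 f (f' z).
  by rewrite in_itv /= => /andP[/ltW az /ltW zb]; apply: (df z _); rewrite az.
have cf : {within `[a, b], continuous f}.
  apply: continuous_in_subspaceT => z; rewrite inE /= in_itv /= => zab.
  exact: derive_continuous (df _ zab).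
have [c /andP[ac cb] E] := MVT ab df' cf.
rewrite -subr_gt0 E mulr_gt0 ?subr_gt0 // f'0 //.
by move: ac cb; rewrite !bnd_simp => /ltW -> /ltW ->.
Qed.

(* If [z |-> F (x, z)] is increasing on a common interval, then the zero set is
   the graph of a continuous function: the signs at two nearby abscissas
   persist, and trap the zero between them. *)
Lemma implicit_continuous F (x0 u0 r : R) : 0 < r ->
  (forall q, `|q.1 - x0| < r -> `|q.2 - u0| < r -> {for q, continuous F}) ->
  (forall x y z : R, `|x - x0| < r -> u0 - r < y -> y < z -> z < u0 + r ->
    F (x, y) < F (x, z)) ->
  F (x0, u0) = 0 ->
  exists u, u x0 = u0 /\ \forall x \near x0,
    [/\ F (x, u x) = 0, {for x, continuous u} & `|u x - u0| < r].
Proof.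
move=> r0 cF incF F0.
have cFx x y : `|x - x0| < r -> `|y - u0| < r ->
    {for x, continuous (fun z => F (z, y))}.
  move=> xr yr; apply: (@continuous_comp _ _ _ (fun z => (z, y)) F).
    by apply: continuous_pair; [exact: cvg_id | exact: cvg_cst].
  exact: cF.
have cFy x y : `|x - x0| < r -> `|y - u0| < r ->
    {for y, continuous (fun z => F (x, z))}.
  move=> xr yr; apply: (@continuous_comp _ _ _ (fun z => (x, z)) F).
    by apply: continuous_pair; [exact: cvg_cst | exact: cvg_id].
  exact: cF.
have xx0 : `|x0 - x0| < r by rewrite subrr normr0.
have sgn (x y z : R) : `|x - x0| < r -> u0 - r < y -> y < z -> z < u0 + r ->
    F (x, y) < 0 -> 0 < F (x, z) ->
    \forall x' \near x, [/\ `|x' - x0| < r, F (x', y) < 0 & 0 < F (x', z)].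
  move=> xr ry yz zr Fy Fz.
  have yr : `|y - u0| < r by rewrite ltr_norml; lra.
  have zr' : `|z - u0| < r by rewrite ltr_norml; lra.
  near=> x'; split.
  - by near: x'; exact: near_dist_lt.
  - by near: x'; exact: near_continuous_lt (cFx _ _ xr yr) Fy.
  - by near: x'; exact: near_continuous_gt (cFx _ _ xr zr') Fz.
(* Half the radius leaves room to move up and down from a zero while staying in the interval where
   [F] is increasing. *)
pose s := r / 2.
have s0 : 0 < s by rewrite /s; lra.
have rE : r = s + s by rewrite /s; lra.
clearbody s.
have near0 : \forall x \near x0,
    [/\ `|x - x0| < r, F (x, u0 - s) < 0 & 0 < F (x, u0 + s)].
  apply: sgn => //; try lra.
  - by rewrite -[X in _ < X]F0; apply: incF => //; lra.
  - by rewrite -[X in X < _]F0; apply: incF => //; lra.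
(* The conditions are put under the existential, with default 0, so that [choice] yields a total
   function. *)
have ex x : exists z, `|x - x0| < r -> F (x, u0 - s) < 0 -> 0 < F (x, u0 + s) ->
    u0 - s < z < u0 + s /\ F (x, z) = 0.
  have [xr|] := boolP (`|x - x0| < r); last by exists 0.
  have [Fm|] := boolP (F (x, u0 - s) < 0); last by exists 0.
  have [Fp|] := boolP (0 < F (x, u0 + s)); last by exists 0.
  have [|||z zI Fz] := @IVT R (fun z => F (x, z)) (u0 - s) (u0 + s) 0.
  - by rewrite lerD2l; apply: ltW; rewrite gtrN.
  - apply: continuous_in_subspaceT => z; rewrite inE /= in_itv /= => zI.
    by apply: cFy => //; rewrite ltr_norml; lra.
  - by rewrite ge_min le_max (ltW Fm) (ltW Fp) orbT.
  exists z => _ _ _; split => //.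
  move: zI; rewrite in_itv /= => /andP[z1 z2]; rewrite !lt_neqAle z1 z2 !andbT.
  apply/andP; split; apply/eqP => zE.
  - by move: Fm; rewrite zE Fz ltxx.
  - by move: Fp; rewrite -zE Fz ltxx.
have [u uP] := choice ex.
have zero_lt (x y z : R) : `|x - x0| < r -> u0 - r < y < u0 + r -> u0 - r < z < u0 + r ->
    F (x, y) < F (x, z) -> y < z.
  move=> xr yr zr; apply: contraTT; rewrite -!leNgt le_eqVlt => /predU1P[->//|zy].
  by apply/ltW/incF => //; lra.
exists u; split.
  have [_ Fm Fp] := nbhs_singleton near0.
  have [uI Fu] := uP _ xx0 Fm Fp.
  apply/eqP; rewrite eq_le !leNgt; apply/andP; split; apply/negP => ux.
  - have : F (x0, u0) < F (x0, u x0) by apply: incF => //; lra.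
    by rewrite Fu F0 ltxx.
  - have : F (x0, u x0) < F (x0, u0) by apply: incF => //; lra.
    by rewrite Fu F0 ltxx.
(* Continuity of [u] is claimed at every point near [x0], so the sign conditions are needed around
   each such point. *)
have : \forall x \near x0, \forall x' \near x,
    [/\ `|x' - x0| < r, F (x', u0 - s) < 0 & 0 < F (x', u0 + s)].
  exact: nbhs_interior near0.
apply: filterS => x nx.
have [xr Fm Fp] := nbhs_singleton nx.
have [uI Fu] := uP _ xr Fm Fp.
split=> //; last by rewrite ltr_norml; lra.
apply/cvgrPdist_lt => e e0.
pose d := Num.min e (s / 2).
have d0 : 0 < d by rewrite /d lt_min e0 /=; lra.
have de : d <= e by rewrite /d ge_min lexx.
have ds : d <= s / 2 by rewrite /d ge_min lexx orbT.
have : \forall x' \near x,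
    [/\ `|x' - x0| < r, F (x', u x - d) < 0 & 0 < F (x', u x + d)].
  apply: sgn => //; try lra.
  - by rewrite -[X in _ < X]Fu; apply: incF => //; lra.
  - by rewrite -[X in X < _]Fu; apply: incF => //; lra.
move: nx; apply: filterS2 => x' [x'r Fm' Fp'] [_ Fl Fr].
have [uI' Fu'] := uP _ x'r Fm' Fp'.
have h1 : u x - d < u x'.
  by apply: (zero_lt x') => //; rewrite ?Fu' //; lra.
have h2 : u x' < u x + d.
  by apply: (zero_lt x') => //; rewrite ?Fu' //; lra.
by rewrite ltr_norml; lra.
Unshelve. all: by end_near. Qed.

Lemma implicit_derive F u x a b : cdiff F (x, u x) a b -> b != 0 ->
  {for x, continuous u} -> (\forall z \near x, F (z, u z) = 0) ->
  is_derive x 1 u (- a / b).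
Proof.
move=> [P [N [cP cN <- <- FE]]] N0 cu Fu.
have cxu : {for x, continuous (fun z => (z, u z))}.
  by apply: continuous_pair => //; exact: cvg_id.
have cPu := @continuous_comp _ _ _ (fun z => (z, u z)) P x cxu cP.
have cNu := @continuous_comp _ _ _ (fun z => (z, u z)) N x cxu cN.
apply: (@is_derive_near_caratheodory _ u (fun z => - P (z, u z) / N (z, u z)) x).
  by apply: cvgM; [exact: cvgN | exact: cvgV].
have F0 : F (x, u x) = 0 by exact: nbhs_singleton Fu.
near=> z.
have Nz : N (z, u z) != 0.
  by near: z; apply: (@cvgr_neq0 _ _ _ (nbhs x) _ _ _ cNu).
have Fz : F (z, u z) = 0 by near: z.
have := FE (z, u z); rewrite F0 Fz subrr /= => /esym/eqP.
rewrite addr_eq0 => /eqP E.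
have {}E : N (z, u z) * (u z - u x) = - (P (z, u z) * (z - x)) by rewrite E opprK.
by apply: (mulfI Nz); rewrite E; field.
Unshelve. all: by end_near. Qed.

Lemma implicit_function_pos k F (x0 u0 l : R) : smooth2 k.+1 F (x0, u0) ->
  F (x0, u0) = 0 -> is_derive u0 1 (fun z => F (x0, z)) l -> 0 < l ->
  exists u, [/\ u x0 = u0, \forall x \near x0, F (x, u x) = 0
    & smooth1 k.+1 u x0].
Proof.
move=> [Fx [Fy [dF sFx sFy]]] F0 dFy l0.
have Fy0 : Fy (x0, u0) = l.
  have [_ <-] := cdiff_snd_derive (nbhs_singleton dF).
  by case: dFy => _ <-.
have Fypos : \forall q \near (x0, u0), 0 < Fy q.
  by apply: near_continuous_gt (smooth2_continuous sFy) _; rewrite Fy0.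
have /nbhs_ballP[r /= r0 ballP] : \forall q \near (x0, u0),
    cdiff F q (Fx q) (Fy q) /\ 0 < Fy q by near=> q; split; near: q.
have goodq q : `|q.1 - x0| < r -> `|q.2 - u0| < r ->
    cdiff F q (Fx q) (Fy q) /\ 0 < Fy q.
  by move=> h1 h2; apply: ballP; split; rewrite /ball /= distrC.
have [||//|u [ux0 uP]] := @implicit_continuous F x0 u0 r r0.
- by move=> q h1 h2; have [/cdiff_continuous] := goodq q h1 h2.
- move=> x y z xr ry yz zr.
  have good t : y <= t <= z -> cdiff F (x, t) (Fx (x, t)) (Fy (x, t)) /\ 0 < Fy (x, t).
    by move=> yt; apply: goodq => //=; rewrite ltr_norml; lra.
  apply: (@is_derive_incr (fun t => F (x, t)) (fun t => Fy (x, t))) => // t tI.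
  - by have [dFt _] := good _ tI; exact: cdiff_snd_derive dFt.
  - by have [] := good _ tI.
have du : \forall x \near x0,
    is_derive (x : R) 1 u (- Fx (x, u x) * (Fy (x, u x))^-1).
  have xr : \forall x \near x0, `|x - x0| < r.
    by apply: near_dist_lt; rewrite subrr normr0.
  move: (nbhs_interior uP) xr; apply: filterS2 => x nx xr.
  have [_ cu uxr] := nbhs_singleton nx.
  have [dFx Fyx] := goodq (x, u x) xr uxr.
  apply: (implicit_derive dFx) => //; first by rewrite gt_eqF.
  by apply: filterS nx => z [].
exists u; split=> //; first by apply: filterS uP => x [].
(* Bootstrap: if [u] is C^j, then its derivative [-Fx / Fy] along the graph is C^j, hence [u] is
   C^(j+1). *)
have su : forall j, (j <= k.+1)%N -> smooth1 j u x0.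
  elim=> [_|j IH jk]; first by apply: filterS uP => x [].
  exists (fun x => -1 * Fx (x, u x) * (Fy (x, u x))^-1); split.
    by apply: filterS du => x; rewrite mulN1r.
  apply: (@smooth_curve _ j (fun q => -1 * Fx q * (Fy q)^-1)); last exact/IH/ltnW.
  rewrite ux0; apply: smooth2M.
    by apply: smooth2M; [exact: smooth2_cst | exact: smooth2_le sFx].
  apply: smooth2_comp; last exact: smooth2_le sFy.
  by apply: smooth1V; rewrite Fy0 gt_eqF.
exact: (su k.+1 (leqnn _)).
Unshelve. all: by end_near. Qed.

Theorem implicit_function k F (x0 u0 l : R) : smooth2 k.+1 F (x0, u0) ->
  F (x0, u0) = 0 -> is_derive u0 1 (fun z => F (x0, z)) l -> l != 0 ->
  exists u, [/\ u x0 = u0, \forall x \near x0, F (x, u x) = 0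
    & smooth1 k.+1 u x0].
Proof.
move=> sF F0 dF; case: (ltgtP l 0) => // l0 _; last exact: implicit_function_pos dF l0.
have [||||u [ux0 Fu su]] := @implicit_function_pos k (fun q => -1 * F q) x0 u0 (- l).
- by apply: smooth2M => //; exact: smooth2_cst.
- by rewrite F0 mulr0.
- apply: is_derive_eq (is_derive_mul (is_derive_cst (-1 : R) u0 1) dF) _.
  by rewrite mul0r add0r mulN1r.
- by rewrite oppr_gt0.
exists u; split=> //; apply: filterS Fu => x /eqP.
by rewrite mulN1r oppr_eq0 => /eqP.
Qed.

End ImplicitFunction.

(** * Criticality as a scalar equation *)

Section Entropy.
Variable R : realType.
Implicit Types (a b c d e t x z : R).

Definition So1 z : R := - 2^-1 * (ln z - ln (1 - z)).
Definition So2 z : R := - 2^-1 * (z^-1 + (1 - z)^-1).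

Lemma is_derive_addf (f g : R -> R) x a b : is_derive x 1 f a ->
  is_derive x 1 g b -> is_derive x 1 (fun z => f z + g z) (a + b).
Proof. by move=> df dg; exact: is_deriveD. Qed.

Lemma is_derive_subf (f g : R -> R) x a b : is_derive x 1 f a ->
  is_derive x 1 g b -> is_derive x 1 (fun z => f z - g z) (a - b).
Proof. by move=> df dg; exact: is_deriveB. Qed.

Lemma is_derive_compf (f g : R -> R) x a b : is_derive (g x) 1 f a ->
  is_derive x 1 g b -> is_derive x 1 (fun z => f (g z)) (a * b).
Proof. by move=> df dg; exact: (@is_derive1_comp _ f g). Qed.

Lemma is_derive_scale (c : R) (f : R -> R) x a : is_derive x 1 f a ->
  is_derive x 1 (fun z => c * f z) (c * a).
Proof. by move=> df; exact: is_deriveZ. Qed.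

Lemma is_derive_ext (f g : R -> R) x a b : is_derive x 1 f a -> f =1 g ->
  a = b -> is_derive x 1 g b.
Proof. by move=> df /funext <- <-. Qed.

Lemma is_derive_1sub x : is_derive x 1 (fun z => 1 - z) (- 1).
Proof.
rewrite -[-1]add0r.
exact: (is_derive_subf (is_derive_cst (1 : R) x 1) (is_derive_id x 1)).
Qed.

Lemma is_derive_So z : 0 < z < 1 -> is_derive z 1 (@So R) (So1 z).
Proof.
move=> /andP[z0 z1]; have z1' : 0 < 1 - z by rewrite subr_gt0.
have dln := is_derive1_ln z0.
have dln1 := @is_derive_compf _ (fun z => 1 - z) _ _ _
  (is_derive1_ln z1') (is_derive_1sub z).
have dzln := is_derive_mul (is_derive_id z 1) dln.
have d1 := is_derive_mul (is_derive_1sub z) dln1.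
apply: is_derive_ext (is_derive_scale (- 2^-1) (is_derive_addf dzln d1)) _ _ => //.
by rewrite /So1; field; rewrite !gt_eqF.
Qed.

Lemma is_derive_So1 z : 0 < z < 1 -> is_derive z 1 So1 (So2 z).
Proof.
move=> /andP[z0 z1]; have z1' : 0 < 1 - z by rewrite subr_gt0.
have dln := is_derive1_ln z0.
have dln1 := @is_derive_compf _ (fun z => 1 - z) _ _ _
  (is_derive1_ln z1') (is_derive_1sub z).
apply: is_derive_ext (is_derive_scale (- 2^-1) (is_derive_subf dln dln1)) _ _ => //.
by rewrite /So2; ring.
Qed.

(** The logarithms disappear after one differentiation: [So2] is rational. Proving order [k.+1] and
    weakening avoids a separate case [k = 0]. *)
Lemma smooth1_So1 k z : 0 < z < 1 -> smooth1 k So1 z.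
Proof.
move=> z01; apply: (@smooth1S _ k); exists So2; split.
  have /andP[z0 z1] := z01; near=> y; apply: is_derive_So1.
  apply/andP; split; near: y.
  - by apply: (@near_continuous_gt _ _ id) => //; exact: cvg_id.
  - by apply: (@near_continuous_lt _ _ id) => //; exact: cvg_id.
have /andP[z0 z1] := z01.
apply: smooth1M; first exact: smooth1_cst.
apply: smooth1D; first by apply: smooth1V; rewrite gt_eqF.
apply: (@smooth1_comp _ k GRing.inv (fun z => 1 - z)).
  by apply: smooth1V; rewrite gt_eqF // subr_gt0.
apply: smooth1D; first exact: smooth1_cst.
have -> : -%R = (fun y : R => -1 * y) by apply/funext => y; rewrite mulN1r.
by apply: smooth1M; [exact: smooth1_cst | exact: smooth1_id].
Unshelve. all: by end_near. Qed.

Lemma not_free3P (K : fieldType) (n : nat) (x y z : 'rV[K]_n) :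
  ~~ free [:: x; y; z] <->
  exists k : K * K * K,
    k != 0 /\ k.1.1 *: x + k.1.2 *: y + k.2 *: z = 0.
Proof.
split=> [nf|[[[k1 k2] k3] [/= k0 kE]]]; last first.
  apply/negP => /(@freeP _ _ 3 [tuple x; y; z]) /(_ (fun i => [:: k1; k2; k3]`_i)).
  rewrite !big_ord_recl big_ord0 /= addr0 addrA => /(_ kE) kk.
  move: k0; have /= -> := kk ord0; have /= -> := kk (lift ord0 ord0).
  by have /= -> := kk (lift ord0 (lift ord0 ord0)); rewrite eqxx.
apply: contrapT => nex; move/negP: nf; apply.
apply/(@freeP _ _ 3 [tuple x; y; z]) => k.
rewrite !big_ord_recl big_ord0 /= addr0 addrA => kE i.
apply: contrapT => ki; apply: nex.
exists (k ord0, k (lift ord0 ord0), k (lift ord0 (lift ord0 ord0))).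
split=> //; apply: contra_notN ki => /eqP[k0 k1 k2].
case: i => [[|[|[|//]]]] i.
- by rewrite -[RHS]k0; congr k; exact: val_inj.
- by rewrite -[RHS]k1; congr k; exact: val_inj.
- by rewrite -[RHS]k2; congr k; exact: val_inj.
Qed.

Lemma derive1_val (f : R -> R) x l : is_derive x 1 f l -> derive1 f x = l.
Proof. by move=> df; rewrite derive1E derive_val. Qed.

Lemma is_derive_cubic (k0 k1 k2 k3 : R) x :
  is_derive x 1 (fun z => k0 + k1 * z + k2 * z ^+ 2 + k3 * z ^+ 3)
    (k1 + 2 * k2 * x + 3 * k3 * x ^+ 2).
Proof.
have di : is_derive x 1 id (1 : R) by exact: is_derive_id.
have d2 := is_derive_mul di di; have d3 := is_derive_mul di d2.
have dc : is_derive x 1 (fun=> k0) 0 by exact: is_derive_cst.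
apply: is_derive_ext (is_derive_addf (is_derive_addf (is_derive_addf dc
  (is_derive_scale k1 di)) (is_derive_scale k2 d2)) (is_derive_scale k3 d3)) _ _.
  by move=> z /=; ring.
by rewrite /=; ring.
Qed.

Lemma derive1_cubic (k0 k1 k2 k3 : R) (f : R -> R) x :
  f =1 (fun z => k0 + k1 * z + k2 * z ^+ 2 + k3 * z ^+ 3) ->
  derive1 f x = k1 + 2 * k2 * x + 3 * k3 * x ^+ 2.
Proof.
move=> fE; apply: derive1_val.
by apply: is_derive_ext (is_derive_cubic k0 k1 k2 k3 x) _ _.
Qed.

Lemma derive1_addSo (k0 k1 : R) (f : R -> R) x : 0 < x < 1 ->
  f =1 (fun z => k0 + k1 * So z) -> derive1 f x = k1 * So1 x.
Proof.
move=> x01 fE; apply: derive1_val; 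
have dc : is_derive x 1 (fun=> k0) 0 by exact: is_derive_cst.
apply: is_derive_ext (is_derive_addf dc (is_derive_scale k1 (is_derive_So x01))) _ _.
  by move=> z; rewrite fE.
by rewrite add0r.
Qed.

(* The 3 x 3 determinant of the gradients, up to a nonzero factor and after
   elimination of the row of [bip_edge]. *)
Definition crit a b c d : R :=
  (So1 a - So1 d) * (c * d * (d - a) + (1 - c) * b * (b - d))
  - (So1 b - So1 d) * (c * a * (a - d) + (1 - c) * d * (d - b)).

Lemma constrained_criticalE a b c d : 0 < a < 1 -> 0 < b < 1 -> 0 < d < 1 ->
  constrained_critical a b c d <-> exists k : R * R * R, [/\ k != 0,
    k.1.1 * c ^+ 2 + k.1.2 * (3 * c ^+ 2 * (c * a ^+ 2 + (1 - c) * d ^+ 2))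
      + k.2 * (c ^+ 2 * So1 a) = 0,
    k.1.1 * (1 - c) ^+ 2
      + k.1.2 * (3 * (1 - c) ^+ 2 * (c * d ^+ 2 + (1 - c) * b ^+ 2))
      + k.2 * ((1 - c) ^+ 2 * So1 b) = 0 &
    k.1.1 * (2 * c * (1 - c))
      + k.1.2 * (6 * c * (1 - c) * (c * a * d + (1 - c) * b * d))
      + k.2 * (2 * c * (1 - c) * So1 d) = 0].
Proof.
move=> a01 b01 d01.
have gE : grad_abd (@bip_edge R) a b c d =
    \row_j [:: c ^+ 2; (1 - c) ^+ 2; 2 * c * (1 - c)]`_j.
  apply/rowP => -[[|[|[|//]]]] i; rewrite !mxE /=.
  - rewrite (@derive1_cubic (2 * c * (1 - c) * d + (1 - c) ^+ 2 * b) (c ^+ 2) 0 0).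
      by ring.
    by move=> z; rewrite /bip_edge; ring.
  - rewrite (@derive1_cubic (c ^+ 2 * a + 2 * c * (1 - c) * d) ((1 - c) ^+ 2) 0 0).
      by ring.
    by move=> z; rewrite /bip_edge; ring.
  - rewrite (@derive1_cubic (c ^+ 2 * a + (1 - c) ^+ 2 * b) (2 * c * (1 - c)) 0 0).
      by ring.
    by move=> z; rewrite /bip_edge; ring.
have gT : grad_abd (@bip_triangle R) a b c d =
    \row_j [:: 3 * c ^+ 2 * (c * a ^+ 2 + (1 - c) * d ^+ 2);
               3 * (1 - c) ^+ 2 * (c * d ^+ 2 + (1 - c) * b ^+ 2);
               6 * c * (1 - c) * (c * a * d + (1 - c) * b * d)]`_j.
  apply/rowP => -[[|[|[|//]]]] i; rewrite !mxE /=.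
  - rewrite (@derive1_cubic
      (3 * c * (1 - c) ^+ 2 * b * d ^+ 2 + (1 - c) ^+ 3 * b ^+ 3)
      (3 * c ^+ 2 * (1 - c) * d ^+ 2) 0 (c ^+ 3)); first by ring.
    by move=> z; rewrite /bip_triangle; ring.
  - rewrite (@derive1_cubic (c ^+ 3 * a ^+ 3 + 3 * c ^+ 2 * (1 - c) * a * d ^+ 2)
      (3 * c * (1 - c) ^+ 2 * d ^+ 2) 0 ((1 - c) ^+ 3)); first by ring.
    by move=> z; rewrite /bip_triangle; ring.
  - rewrite (@derive1_cubic (c ^+ 3 * a ^+ 3 + (1 - c) ^+ 3 * b ^+ 3) 0
      (3 * c ^+ 2 * (1 - c) * a + 3 * c * (1 - c) ^+ 2 * b) 0); first by ring.
    by move=> z; rewrite /bip_triangle; ring.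
have gS : grad_abd (@bip_entropy R) a b c d =
    \row_j [:: c ^+ 2 * So1 a; (1 - c) ^+ 2 * So1 b; 2 * c * (1 - c) * So1 d]`_j.
  apply/rowP => -[[|[|[|//]]]] i; rewrite !mxE /=.
  - apply: (@derive1_addSo ((1 - c) ^+ 2 * So b + 2 * c * (1 - c) * So d)) => // z.
    by rewrite /bip_entropy; ring.
  - apply: (@derive1_addSo (c ^+ 2 * So a + 2 * c * (1 - c) * So d)) => // z.
    by rewrite /bip_entropy; ring.
  - exact: (@derive1_addSo (c ^+ 2 * So a + (1 - c) ^+ 2 * So b)).
rewrite /constrained_critical gE gT gS; apply: (iff_trans (not_free3P _ _ _)).
split=> -[[[k1 k2] k3] kP]; exists (k1, k2, k3); move: kP => /=.
- move=> [k0 /rowP kE]; split=> //.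
  + by have := kE (inord 0); rewrite !mxE !inordK.
  + by have := kE (inord 1); rewrite !mxE !inordK.
  + by have := kE (inord 2); rewrite !mxE !inordK.
- move=> [k0 kE1 kE2 kE3]; split=> //.
  by apply/rowP => -[[|[|[|//]]]] i; rewrite !mxE /=.
Qed.

(** After division of the rows by the weights c^2, (1-c)^2 and 2c(1-c), subtracting the [d] row from
    the other two eliminates [k1]. Two equations in [(k2, k3)] remain, and [crit] is their
    determinant up to a constant. *)
Lemma constrained_critical_crit a b c d : 0 < a < 1 -> 0 < b < 1 -> 0 < c < 1 ->
  0 < d < 1 -> constrained_critical a b c d -> crit a b c d = 0.
Proof.
move=> a01 b01 /andP[c0 c1] d01 /(constrained_criticalE c a01 b01 d01).
move=> [[[k1 k2] k3]] [/= k0 E1 E2 E3].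
have c0' : c != 0 by rewrite gt_eqF.
have c1' : 1 - c != 0 by rewrite subr_eq0 gt_eqF.
have {}E1 : k1 + 3 * k2 * (c * a ^+ 2 + (1 - c) * d ^+ 2) + k3 * So1 a = 0.
  by apply: (mulfI (expf_neq0 2 c0')); rewrite mulr0 -[RHS]E1; ring.
have {}E2 : k1 + 3 * k2 * (c * d ^+ 2 + (1 - c) * b ^+ 2) + k3 * So1 b = 0.
  by apply: (mulfI (expf_neq0 2 c1')); rewrite mulr0 -[RHS]E2; ring.
have {}E3 : k1 + 3 * k2 * (c * a * d + (1 - c) * b * d) + k3 * So1 d = 0.
  have h : 2 * c * (1 - c) != 0 by rewrite !mulf_neq0 // pnatr_eq0.
  by apply: (mulfI h); rewrite mulr0 -[RHS]E3; ring.
(* If [k3] vanishes, then [k2] does not, and both triangle coefficients in [crit] are zero. *)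
have [k30|k30] := eqVneq k3 0; last first.
  apply: (mulfI k30); rewrite mulr0 /crit.
  transitivity ((c * d * (d - a) + (1 - c) * b * (b - d))
      * ((k1 + 3 * k2 * (c * a ^+ 2 + (1 - c) * d ^+ 2) + k3 * So1 a)
        - (k1 + 3 * k2 * (c * a * d + (1 - c) * b * d) + k3 * So1 d))
    - (c * a * (a - d) + (1 - c) * d * (d - b))
      * ((k1 + 3 * k2 * (c * d ^+ 2 + (1 - c) * b ^+ 2) + k3 * So1 b)
        - (k1 + 3 * k2 * (c * a * d + (1 - c) * b * d) + k3 * So1 d))).
    by ring.
  by rewrite E1 E2 E3; ring.
have [k20|k20] := eqVneq k2 0.
  move: k0; rewrite k20 k30; have -> : k1 = 0 by rewrite k20 k30 in E1; lra.
  by rewrite eqxx.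
have E13 : c * a * (a - d) + (1 - c) * d * (d - b) = 0.
  by apply: (mulfI k20); rewrite k30 in E1 E3; lra.
have E23 : c * d * (d - a) + (1 - c) * b * (b - d) = 0.
  by apply: (mulfI k20); rewrite k30 in E2 E3; lra.
by rewrite /crit E13 E23; ring.
Qed.

Lemma crit_constrained_critical a b c d : 0 < a < 1 -> 0 < b < 1 ->
  0 < d < 1 -> c * a * (a - d) + (1 - c) * d * (d - b) != 0 ->
  crit a b c d = 0 -> constrained_critical a b c d.
Proof.
move=> a01 b01 d01 nz cr; apply/(constrained_criticalE c a01 b01 d01).
set X := c * a * (a - d) + (1 - c) * d * (d - b) in nz *.
(* These multipliers solve the [a] and [d] rows identically. The [b] row is then a multiple of
   [crit], and [X != 0] makes the vector nonzero. *)
exists ((So1 a - So1 d) * 3 * (c * a * d + (1 - c) * b * d) - 3 * X * So1 d,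
  - (So1 a - So1 d), 3 * X); rewrite /=; split.
- by apply/negP => /eqP[_ _ /eqP]; rewrite mulf_eq0 pnatr_eq0 (negPf nz).
- by rewrite /X; ring.
- transitivity (- 3 * (1 - c) ^+ 2 * crit a b c d); last by rewrite cr mulr0.
  by rewrite /crit /X; ring.
- by ring.
Qed.

End Entropy.

(** * Second derivative of the entropy along a critical curve *)

Section Curvature.
Variable R : realType.
Implicit Types (a b c d e s t x z : R).

(** Taylor data of order two. The derivative [f'] is required near [x] but is differentiated only at
    [x]; second derivatives then become algebra on triples. *)
Definition jet2 (f : R -> R) x (f0 f1 f2 : R) : Prop :=
  exists f' : R -> R, [/\ f x = f0, \forall z \near x, is_derive (z : R) 1 f (f' z),
    f' x = f1 & is_derive x 1 f' f2].

Lemma jet2_ext (f g : R -> R) x f0 f1 f2 : f =1 g -> jet2 f x f0 f1 f2 ->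
  jet2 g x f0 f1 f2.
Proof. by move=> /funext ->. Qed.

Lemma jet2_cst (k : R) x : jet2 (fun=> k) x k 0 0.
Proof.
exists (fun=> 0); split => //; last exact: is_derive_cst.
by apply: (@nearW _ (nbhs x)) => z; exact: is_derive_cst.
Qed.

Lemma jet2_id x : jet2 id x x 1 0.
Proof.
exists (fun=> 1); split => //; last exact: is_derive_cst.
by apply: (@nearW _ (nbhs x)) => z; exact: is_derive_id.
Qed.

Lemma jet2D (f g : R -> R) x f0 f1 f2 g0 g1 g2 : jet2 f x f0 f1 f2 ->
  jet2 g x g0 g1 g2 -> jet2 (fun z => f z + g z) x (f0 + g0) (f1 + g1) (f2 + g2).
Proof.
move=> [f' [<- df <- df']] [g' [<- dg <- dg']].
exists (fun z => f' z + g' z); split => //; last exact: is_derive_addf.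
by apply: filterS2 df dg => z; exact: is_derive_addf.
Qed.

Lemma jet2M (f g : R -> R) x f0 f1 f2 g0 g1 g2 : jet2 f x f0 f1 f2 ->
  jet2 g x g0 g1 g2 -> jet2 (fun z => f z * g z) x (f0 * g0)
    (f1 * g0 + f0 * g1) (f2 * g0 + 2 * f1 * g1 + f0 * g2).
Proof.
move=> [f' [<- df <- df']] [g' [<- dg <- dg']].
exists (fun z => f' z * g z + f z * g' z); split => //.
  by apply: filterS2 df dg => z; exact: is_derive_mul.
apply: is_derive_ext (is_derive_addf
  (is_derive_mul df' (nbhs_singleton dg))
  (is_derive_mul (nbhs_singleton df) dg')) _ _ => //.
by ring.
Qed.

Lemma jet2_comp (f g : R -> R) x f0 f1 f2 g0 g1 g2 : jet2 f g0 f0 f1 f2 ->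
  jet2 g x g0 g1 g2 ->
  jet2 (fun z => f (g z)) x f0 (f1 * g1) (f2 * g1 ^+ 2 + f1 * g2).
Proof.
move=> [f' [<- df <- df']] [g' [gx dg <- dg']]; rewrite -gx in df df' *.
have cg := derive_continuous (nbhs_singleton dg).
exists (fun z => f' (g z) * g' z); split => //.
  have := cg _ df; move: dg; apply: filterS2 => z dg dfz.
  exact: is_derive_compf.
apply: is_derive_ext (is_derive_mul
  (is_derive_compf df' (nbhs_singleton dg)) dg') _ _ => //.
by ring.
Qed.

Lemma near01 z : 0 < z < 1 -> \forall y \near z, 0 < y < 1.
Proof.
move=> /andP[z0 z1]; near=> y; apply/andP; split; near: y.
- by apply: (@near_continuous_gt _ _ id) => //; exact: cvg_id.
- by apply: (@near_continuous_lt _ _ id) => //; exact: cvg_id.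
Unshelve. all: by end_near. Qed.

Lemma near01_comp (f : R -> R) x : {for x, continuous f} -> 0 < f x < 1 ->
  \forall y \near x, 0 < f y < 1.
Proof. by move=> cf f01; have := cf _ (near01 f01). Qed.

Lemma jet2_So z : 0 < z < 1 -> jet2 (@So R) z (So z) (So1 z) (So2 z).
Proof.
move=> z01; exists (@So1 R); split; [reflexivity | | reflexivity | exact: is_derive_So1].
by apply: filterS (near01 z01) => y; exact: is_derive_So.
Qed.

Lemma twice_derivable_jet2 (f : R -> R) x : twice_derivable_near f x ->
  exists f1 f2, jet2 f x (f x) f1 f2.
Proof.
move=> df; exists (derive1 f x), (derive1 (derive1 f) x), (derive1 f).
split; [reflexivity | | reflexivity |].
  by apply: filterS df => z [dfz _]; rewrite derive1E; exact/derivableP.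
have [_ d2f] := nbhs_singleton df.
by rewrite [X in is_derive _ _ _ X]derive1E; exact/derivableP.
Qed.

(** Used with a constant [g], it differentiates a constraint twice along the curve. *)
Lemma jet2_near_eq (f g : R -> R) x f0 f1 f2 g0 g1 g2 :
  (\forall z \near x, f z = g z) ->
  jet2 f x f0 f1 f2 -> jet2 g x g0 g1 g2 -> f1 = g1 /\ f2 = g2.
Proof.
move=> fg [f' [_ df <- df']] [g' [_ dg <- dg']].
have fg' : \forall z \near x, f' z = g' z.
  have nfg : \forall z \near x, \forall y \near z, f y = g y.
    exact: nbhs_interior fg.
  near=> z.
  have dfz : is_derive (z : R) 1 f (f' z) by near: z.
  have dgz : is_derive (z : R) 1 g (g' z) by near: z.
  rewrite -(derive1_val dfz) -(derive1_val dgz) !derive1E.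
  by apply: near_eq_derive; near: z.
split; first exact: nbhs_singleton fg'.
by case: df' dg' => [_ <-] [_ <-]; exact: near_eq_derive.
Unshelve. all: by end_near. Qed.

Lemma jet2_derive1n (f : R -> R) x f0 f1 f2 : jet2 f x f0 f1 f2 ->
  derive1n 2 f x = f2.
Proof.
move=> [f' [_ df _ [_ <-]]]; rewrite /derive1n /= derive1E.
by apply: near_eq_derive; apply: filterS df => z; exact: derive1_val.
Qed.

Lemma jet2_is_derive (f : R -> R) x f0 f1 f2 : jet2 f x f0 f1 f2 ->
  is_derive x 1 f f1.
Proof. by move=> [f' [_ df <- _]]; exact: nbhs_singleton df. Qed.

Definition rem2 e d : R := So1 (e + d) - So1 (e - d) - 2 * d * So2 (e - d).
Definition rem3 e d : R :=
  So (e + d) - So (e - d) - 2 * d * So1 (e - d) - 2 * d ^+ 2 * So2 (e - d).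
Definition slope e d : R := (So1 (e + d) - So1 (e - d)) / (2 * d).
(** Up to the factor [- d], this is the derivative of [crit] at the symmetric point in the direction
    (1, -1, 0) of (a, b, d). Its nonvanishing is the nondegeneracy condition for critical curves. *)
Definition wgt e d : R := - (4 * d * So2 (e - d) + 4 * (e - d) * slope e d).
Definition curvature e d : R :=
  - 4 * (rem3 e d - 2 * d * rem2 e d ^+ 2 / wgt e d).

Lemma sym_gap_gt0 e t : t < e ^+ 3 -> 0 < sym_gap e t.
Proof. by move=> te; rewrite /sym_gap powR_gt0 // subr_gt0. Qed.

Lemma sym_gapX3 e t : t <= e ^+ 3 -> sym_gap e t ^+ 3 = e ^+ 3 - t.
Proof.
move=> te; rewrite /sym_gap -powR_mulrn ?powR_ge0 // -powRrM mulVf ?pnatr_eq0 //.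
by rewrite powRr1 // subr_ge0.
Qed.

Lemma jet2_conv (f g : R -> R) x f0 f1 f2 g0 g1 g2 : jet2 f x f0 f1 f2 ->
  f =1 g -> f0 = g0 -> f1 = g1 -> f2 = g2 -> jet2 g x g0 g1 g2.
Proof. by move=> + /funext <- <- <- <-. Qed.

(** It serves the edge density and also the entropy, which has the same shape with [So] composed
    into each entry. At the symmetric point [fa] and [fb] share the value [a]. *)
Lemma jet2_edge_half (fa fb fd : R -> R) a a1 a2 b1 b2 d d1 d2 :
  jet2 fa 2^-1 a a1 a2 -> jet2 fb 2^-1 a b1 b2 -> jet2 fd 2^-1 d d1 d2 ->
  jet2 (fun c => c ^+ 2 * fa c + 2 * c * (1 - c) * fd c + (1 - c) ^+ 2 * fb c)
    2^-1 ((a + d) / 2) ((a1 + b1 + 2 * d1) / 4)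
    (4 * (a - d) + 2 * (a1 - b1) + (a2 + b2 + 2 * d2) / 4).
Proof.
move=> ja jb jd; have jc := jet2_id 2^-1.
have jo := jet2D (jet2_cst 1 2^-1) (jet2M (jet2_cst (-1) 2^-1) jc).
apply: (jet2_conv (jet2D (jet2D (jet2M (jet2M jc jc) ja)
  (jet2M (jet2M (jet2_cst 2 2^-1) (jet2M jc jo)) jd)) (jet2M (jet2M jo jo) jb))).
- by move=> z; ring.
- by field.
- by field.
- by field.
Qed.

Lemma jet2_triangle_half (fa fb fd : R -> R) a a1 a2 b1 b2 d d1 d2 :
  jet2 fa 2^-1 a a1 a2 -> jet2 fb 2^-1 a b1 b2 -> jet2 fd 2^-1 d d1 d2 ->
  jet2 (fun c => bip_triangle (fa c) (fb c) c (fd c))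
    2^-1 ((a ^+ 3 + 3 * a * d ^+ 2) / 4)
    (3 / 8 * (a ^+ 2 + d ^+ 2) * (a1 + b1) + 3 / 2 * a * d * d1)
    (6 * a * (a ^+ 2 - d ^+ 2) + 3 / 2 * (3 * a ^+ 2 + d ^+ 2) * (a1 - b1)
     + 3 / 4 * a * (a1 ^+ 2 + b1 ^+ 2) + 3 / 8 * (a ^+ 2 + d ^+ 2) * (a2 + b2)
     + 3 / 2 * d * d1 * (a1 + b1) + 3 / 2 * a * (d1 ^+ 2 + d * d2)).
Proof.
move=> ja jb jd; have jc := jet2_id 2^-1.
have jo := jet2D (jet2_cst 1 2^-1) (jet2M (jet2_cst (-1) 2^-1) jc).
have jc2 := jet2M jc jc; have jo2 := jet2M jo jo.
have jd2 := jet2M jd jd; have j3 := jet2_cst 3 2^-1.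
apply: (jet2_conv (jet2D (jet2D (jet2D
  (jet2M (jet2M jc2 jc) (jet2M (jet2M ja ja) ja))
  (jet2M (jet2M j3 (jet2M jc2 jo)) (jet2M ja jd2)))
  (jet2M (jet2M j3 (jet2M jc jo2)) (jet2M jb jd2)))
  (jet2M (jet2M jo2 jo) (jet2M (jet2M jb jb) jb)))).
- by move=> z; rewrite /bip_triangle; ring.
- by field.
- by field.
- by field.
Qed.

(** Exchanging the two classes, (a, b, c) to (b, a, 1 - c), changes the sign of [crit]; hence only
    [a1 - b1] and [c1] survive, and [d1] drops out. A general [fc] covers both uses: along a
    critical curve ([c1 = 1]) and at fixed c = 1/2 ([c1 = 0]). *)
Lemma is_derive_crit (fa fb fc fd : R -> R) x a a1 b1 c1 d d1 :
  0 < a < 1 -> 0 < d < 1 ->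
  fa x = a -> fb x = a -> fc x = 2^-1 -> fd x = d ->
  is_derive x 1 fa a1 -> is_derive x 1 fb b1 -> is_derive x 1 fc c1 ->
  is_derive x 1 fd d1 ->
  is_derive x 1 (fun z => crit (fa z) (fb z) (fc z) (fd z))
    ((d - a) ^+ 2 / 2 * So2 a * (a1 - b1)
     + (So1 a - So1 d) * (2 * c1 * (d ^+ 2 - a ^+ 2) - a * (a1 - b1))).
Proof.
move=> a01 d01 faE fbE fcE fdE da db dc dd.
have sa : is_derive (fa x) 1 (@So1 R) (So2 a) by rewrite faE; exact: is_derive_So1.
have sb : is_derive (fb x) 1 (@So1 R) (So2 a) by rewrite fbE; exact: is_derive_So1.
have sd : is_derive (fd x) 1 (@So1 R) (So2 d) by rewrite fdE; exact: is_derive_So1.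
have dsa := is_derive_compf sa da.
have dsb := is_derive_compf sb db.
have dsd := is_derive_compf sd dd.
have d1' : is_derive x 1 (fun=> 1 : R) 0 by exact: is_derive_cst.
have d1c := is_derive_subf d1' dc.
have D := is_derive_subf
  (is_derive_mul (is_derive_subf dsa dsd) (is_derive_addf
    (is_derive_mul (is_derive_mul dc dd) (is_derive_subf dd da))
    (is_derive_mul (is_derive_mul d1c db) (is_derive_subf db dd))))
  (is_derive_mul (is_derive_subf dsb dsd) (is_derive_addf
    (is_derive_mul (is_derive_mul dc da) (is_derive_subf da dd))
    (is_derive_mul (is_derive_mul d1c dd) (is_derive_subf dd db)))).
refine (is_derive_ext D _ _); first by [].
by rewrite /= faE fbE fcE fdE; field.
Qed.

(* The equation [crit = 0] determines [v], then the triangle constraint gives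
   [d2]; the entropy is reduced with the multipliers [So1 a] and [So1 d - So1 a]. *)
Lemma curvatureE e d (v d2 : R) : d != 0 -> wgt e d != 0 ->
  2 * d ^+ 2 * So2 (e - d) * (2 * v)
    + (So1 (e - d) - So1 (e + d)) * (8 * e * d - (e - d) * (2 * v)) = 0 ->
  d ^+ 2 * d2 = 8 * (2 * d - v / 2) * d ^+ 2 + 2 * (e - d) * (2 * d - v / 2) ^+ 2 ->
  4 * (So (e - d) - So (e + d)) + 8 * d * So1 (e - d) + 2^-1 * So2 (e - d) * v ^+ 2
    + 2^-1 * (So1 (e + d) - So1 (e - d)) * d2 = curvature e d.
Proof.
move=> d0 w0 vE d2E.
have vw : v * wgt e d = - 8 * e * (So1 (e + d) - So1 (e - d)).
  apply: (mulfI d0); rewrite /wgt /slope.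
  rewrite -[RHS]addr0 -[X in _ = _ + X](mulr0 (-1)) -vE; field.
  by rewrite d0.
have {}vE : v = - 8 * e * (So1 (e + d) - So1 (e - d)) / wgt e d.
  by rewrite -vw mulfK.
have {}d2E : d2 = 8 * (2 * d - v / 2) + 2 * (e - d) * (2 * d - v / 2) ^+ 2 / d ^+ 2.
  by apply: (mulfI (expf_neq0 2 d0)); rewrite d2E; field; rewrite d0.
rewrite d2E vE /curvature /rem3 /rem2; move: w0; rewrite /wgt /slope.
set s1 := So1 _; set s2 := So1 _; set s3 := So2 _ => w0.
field; rewrite d0 /=.
(* The side condition left by [field] is [wgt] with the inner quotient cleared, that is, multiplied
   by [- (2 * d)]. *)
have -> : 4 * d * s3 * (2 * d) + 4 * (e - d) * (s1 - s2)
    = - (2 * d) * - (4 * d * s3 + 4 * (e - d) * ((s1 - s2) / (2 * d))) by field.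
by rewrite mulf_neq0 // oppr_eq0 mulf_neq0 ?pnatr_eq0.
Qed.

Lemma critical_curve_curvature e t (fa fb fd : R -> R) : t < e ^+ 3 ->
  0 < e - sym_gap e t -> e + sym_gap e t < 1 -> wgt e (sym_gap e t) != 0 ->
  critical_curve e t fa fb fd ->
  derive1n 2 (fun c => bip_entropy (fa c) (fb c) c (fd c)) 2^-1
    = curvature e (sym_gap e t).
Proof.
move=> te; have := sym_gap_gt0 te; set d := sym_gap e t => d0 a0 d1 w0.
move=> [[faE fbE fdE] [ta tb td] near_crit].
rewrite -/d in faE fbE fdE; clearbody d.
have a01 : 0 < e - d < 1 by lra.
have d01 : 0 < e + d < 1 by lra.
have [va [a2]] := twice_derivable_jet2 ta; rewrite faE => ja.
have [vb [b2]] := twice_derivable_jet2 tb; rewrite fbE => jb.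
have [vd [d2]] := twice_derivable_jet2 td; rewrite fdE => jd.
have [E1 E2] : (va + vb + 2 * vd) / 4 = 0 /\
    4 * (e - d - (e + d)) + 2 * (va - vb) + (a2 + b2 + 2 * d2) / 4 = 0.
  apply: jet2_near_eq (jet2_edge_half ja jb jd) (jet2_cst e _).
  by apply: filterS near_crit => c [_ <- _ _].
have [T1 T2] := jet2_near_eq (filterS (fun c cr => let: And4 _ _ h _ := cr in h)
  near_crit) (jet2_triangle_half ja jb jd) (jet2_cst t _).
have d0' : d != 0 by rewrite gt_eqF.
(* With [vb] eliminated by the edge constraint, the first-order triangle constraint reads
   [-3 d^2 vd = 0]. Then [vb = - va]: the curve leaves the symmetric point antisymmetrically. *)
have vd0 : vd = 0.
  apply: (mulfI (expf_neq0 2 d0')); rewrite mulr0.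
  have vbE : vb = - va - 2 * vd by lra.
  rewrite -(mulr0 (- 3^-1)) -T1 vbE.
  by field.
have vbE : vb = - va by rewrite vd0 in E1; lra.
(* [crit] vanishes along the curve near 1/2, so its derivative there is 0; this fixes [va]. *)
have C : (e + d - (e - d)) ^+ 2 / 2 * So2 (e - d) * (va - vb)
    + (So1 (e - d) - So1 (e + d))
      * (2 * ((e + d) ^+ 2 - (e - d) ^+ 2) - (e - d) * (va - vb)) = 0.
  have := is_derive_crit a01 d01 faE fbE (erefl : id (2^-1 : R) = 2^-1) fdE
    (jet2_is_derive ja) (jet2_is_derive jb) (is_derive_id (2^-1 : R) 1)
    (jet2_is_derive jd).
  rewrite mulr1 => dcr.
  have dc0 : is_derive (2^-1 : R) 1 (fun=> 0 : R) 0 by exact: is_derive_cst.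
  rewrite -(derive1_val dc0) -(derive1_val dcr) !derive1E; apply: near_eq_derive.
  have fa01 : \forall c \near (2^-1 : R), 0 < fa c < 1.
    by apply: near01_comp (derive_continuous (jet2_is_derive ja)) _; rewrite faE.
  have fb01 : \forall c \near (2^-1 : R), 0 < fb c < 1.
    by apply: near01_comp (derive_continuous (jet2_is_derive jb)) _; rewrite fbE.
  have fd01 : \forall c \near (2^-1 : R), 0 < fd c < 1.
    by apply: near01_comp (derive_continuous (jet2_is_derive jd)) _; rewrite fdE.
  have c01 : \forall c \near (2^-1 : R), 0 < c < 1 by apply: near01; lra.
  have ncrit : \forall c \near (2^-1 : R), constrained_critical (fa c) (fb c) c (fd c).
    by apply: filterS near_crit => c [].
  by near=> c; apply: constrained_critical_crit; near: c.
have jS := jet2_edge_half (jet2_comp (jet2_So a01) ja) (jet2_comp (jet2_So a01) jb)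
  (jet2_comp (jet2_So d01) jd).
rewrite (jet2_derive1n (jet2_ext _ jS)); last first.
  by move=> c; rewrite /bip_entropy; ring.
(* The second-order edge constraint gives the sum [a2 + b2], the only combination that occurs. The
   second-order triangle constraint then gives [d2]. *)
rewrite -(@curvatureE e d va d2) //.
- have a2E : a2 = - b2 - 2 * d2 - 16 * (va - 2 * d) by rewrite vbE in E2; lra.
  by rewrite a2E vbE vd0; field.
- by rewrite -[RHS]C vbE; field.
- have a2E : a2 = - b2 - 2 * d2 - 16 * (va - 2 * d) by rewrite vbE in E2; lra.
  apply/eqP; rewrite -subr_eq0; apply/eqP; rewrite -(mulr0 (- 3^-1)) -T2 a2E vbE vd0.
  by field.
Unshelve. all: by end_near. Qed.

End Curvature.

(** * Sign of the second derivative near e = 1/2 *)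

Section CurvatureEstimates.
Variable R : realType.
Implicit Types (a b c d e s t x z : R).

(** * Derivatives of the entropy function up to order six *)

Definition So3 z : R := 2^-1 * (z^-1 ^+ 2 - (1 - z)^-1 ^+ 2).
Definition So4 z : R := - (z^-1 ^+ 3 + (1 - z)^-1 ^+ 3).
Definition So5 z : R := 3 * (z^-1 ^+ 4 - (1 - z)^-1 ^+ 4).
Definition So6 z : R := - 12 * (z^-1 ^+ 5 + (1 - z)^-1 ^+ 5).

Lemma is_derive_Vexp n z : z != 0 ->
  is_derive z 1 (fun y => y^-1 ^+ n) (- n%:R * z^-1 ^+ n.+1).
Proof.
move=> z0; have di : is_derive z 1 id (1 : R) by exact: is_derive_id.
have dV : is_derive z 1 (fun y : R => y^-1) (- (z^-1 ^+ 2)).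
  apply: is_derive_ext (@is_deriveV _ id z 1 1 z0 di) _ _; first by [].
  by rewrite /GRing.scale /= mulr1 exprVn.
elim: n => [|n IH].
  by rewrite oppr0 mul0r; exact: is_derive_cst.
apply: is_derive_ext (is_derive_mul dV IH) _ _.
  by move=> y; rewrite exprS.
by rewrite -natr1 !exprS; ring.
Qed.

Lemma is_derive_V1exp n z : z < 1 ->
  is_derive z 1 (fun y => (1 - y)^-1 ^+ n) (n%:R * (1 - z)^-1 ^+ n.+1).
Proof.
move=> z1; have z1' : 1 - z != 0 by rewrite subr_eq0 gt_eqF.
have := @is_derive_compf R (fun y : R => y^-1 ^+ n) (fun y : R => 1 - y) _ _ _
  (is_derive_Vexp n z1') (is_derive_1sub z).
by rewrite mulrN1 mulNr opprK.
Qed.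

Lemma is_derive_So2 z : 0 < z < 1 -> is_derive z 1 (@So2 R) (So3 z).
Proof.
move=> /andP[/gt_eqF/negbT z0 z1].
apply: is_derive_ext (is_derive_scale (- 2^-1) (is_derive_addf
  (is_derive_Vexp 1 z0) (is_derive_V1exp 1 z1))) _ _; first by [].
by rewrite /So3; ring.
Qed.

Lemma is_derive_So3 z : 0 < z < 1 -> is_derive z 1 So3 (So4 z).
Proof.
move=> /andP[/gt_eqF/negbT z0 z1].
apply: is_derive_ext (is_derive_scale 2^-1 (is_derive_subf
  (is_derive_Vexp 2 z0) (is_derive_V1exp 2 z1))) _ _; first by [].
by rewrite /So4; field; rewrite z0 subr_eq0 gt_eqF.
Qed.

Lemma is_derive_So4 z : 0 < z < 1 -> is_derive z 1 So4 (So5 z).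
Proof.
move=> /andP[/gt_eqF/negbT z0 z1].
apply: is_derive_ext (is_derive_scale (-1) (is_derive_addf
  (is_derive_Vexp 3 z0) (is_derive_V1exp 3 z1))) _ _.
  by move=> y; rewrite mulN1r.
by rewrite /So5; ring.
Qed.

Lemma is_derive_So5 z : 0 < z < 1 -> is_derive z 1 So5 (So6 z).
Proof.
move=> /andP[/gt_eqF/negbT z0 z1].
apply: is_derive_ext (is_derive_scale 3 (is_derive_subf
  (is_derive_Vexp 4 z0) (is_derive_V1exp 4 z1))) _ _; first by [].
by rewrite /So6; ring.
Qed.

Lemma inv_bounds z : 4^-1 <= z -> 0 <= z^-1 <= 4.
Proof.
move=> z4; have z0 : 0 < z by apply: lt_le_trans z4; rewrite invr_gt0.
by rewrite invr_ge0 ltW //= -[leRHS]invrK lef_pV2 // posrE ?invr_gt0.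
Qed.

(** On this interval both inverses lie in [0, 4], whence 8 = 4^2 / 2, 768 = 3 * 4^4 and 24 * 1024 =
    12 * 2 * 4^5. At 1/2 the fourth derivative is -16, and 448 = 2 * 224 is a Lipschitz constant
    around it. *)
Lemma So_derivs_bounds z : 4^-1 <= z <= 3 / 4 ->
  [/\ - 4 <= So2 z <= - 2, `|So3 z| <= 8, `|So4 z + 16| <= 448 * `|z - 2^-1|,
      `|So5 z| <= 768 & `|So6 z| <= 24 * 1024].
Proof.
move=> /andP[z4 z34].
have z14 : 4^-1 <= 1 - z by lra.
have := inv_bounds z4; have := inv_bounds z14.
have z0 : z != 0 by rewrite gt_eqF //; apply: lt_le_trans z4; rewrite invr_gt0.
have z1 : 1 - z != 0 by rewrite gt_eqF //; apply: lt_le_trans z14; rewrite invr_gt0.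
have uE : z^-1 * z = 1 by rewrite mulVf.
have wE : (1 - z)^-1 * (1 - z) = 1 by rewrite mulVf.
rewrite /So2 /So3 /So4 /So5 /So6.
move: uE wE; set u := z^-1; set w := (1 - z)^-1 => uE wE /andP[w0 w4] /andP[u0 u4].
have X n (y : R) : 0 <= y -> y <= 4 -> 0 <= y ^+ n <= 4 ^+ n.
  by move=> y0 y4; rewrite exprn_ge0 //= lerXn2r // nnegrE.
have /andP[u20 u2] := X 2 u u0 u4; have /andP[w20 w2] := X 2 w w0 w4.
have /andP[u40 u44] := X 4 u u0 u4; have /andP[w40 w44] := X 4 w w0 w4.
have /andP[u50 u5] := X 5 u u0 u4; have /andP[w50 w5] := X 5 w w0 w4.
split.
- have uw : u + w = u * w.
    by rewrite /u /w; field; rewrite z0 z1.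
  (* This is [z * (1 - z) <= 1/4], written as the nonnegativity of a square times [u * w]. *)
  have : 4 <= u * w.
    have h : u * w * (z * (1 - z)) = 1 by rewrite /u /w; field; rewrite z0 z1.
    have := mulr_ge0 (mulr_ge0 u0 w0) (sqr_ge0 (z - 2^-1)).
    have -> : u * w * (z - 2^-1) ^+ 2 = u * w / 4 - u * w * (z * (1 - z)) by field.
    rewrite h.
    by lra.
  by lra.
- by rewrite ler_norml; lra.
(* Since [y * t = 1], [y - 2 = - 2 y (t - 1/2)]; the constant is 224 = 2 * 4 * (16 + 8 + 4). *)
- have h (y t : R) : 0 <= y -> y <= 4 -> y * t = 1 -> `|y ^+ 3 - 8| <= 224 * `|t - 2^-1|.
    move=> y0 y4 yt.
    have -> : y ^+ 3 - 8 = - ((2 * y * (y ^+ 2 + 2 * y + 4)) * (t - 2^-1)).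
      transitivity ((y - 2 * (y * t)) * (y ^+ 2 + 2 * y + 4)); last by field.
      by rewrite yt; ring.
    rewrite normrN normrM ler_wpM2r // ger0_norm; first by nra.
    by rewrite !mulr_ge0 // !addr_ge0 // ?sqr_ge0 // mulr_ge0.
  have -> : - (u ^+ 3 + w ^+ 3) + 16 = - (u ^+ 3 - 8) - (w ^+ 3 - 8) by ring.
  apply: le_trans (ler_normB _ _) _; rewrite normrN.
  have hu := h _ _ u0 u4 uE; have hw := h _ _ w0 w4 wE.
  have <- : `|1 - z - 2^-1| = `|z - 2^-1| by rewrite -normrN; congr `|_|; field.
  have E : `|1 - z - 2^-1| = `|z - 2^-1| by rewrite -normrN; congr `|_|; field.
  by rewrite E in hw *; lra.
- by rewrite ler_norml; lra.
- by rewrite ler_norml; lra.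
Qed.

Lemma is_derive_nondecr (f f' : R -> R) a b :
  (forall z, a <= z <= b -> is_derive z 1 f (f' z)) ->
  (forall z, a <= z <= b -> 0 <= f' z) -> a <= b -> f a <= f b.
Proof.
move=> df f'0 ab.
have df' z : z \in `]a, b[ -> is_derive z 1 f (f' z).
  by rewrite in_itv /= => /andP[/ltW az /ltW zb]; apply: (df z _); rewrite az.
have cf : {within `[a, b], continuous f}.
  apply: continuous_in_subspaceT => z; rewrite inE /= in_itv /= => zab.
  exact: derive_continuous (df _ zab).
have [c cI E] := MVT_segment ab df' cf.
by rewrite -subr_ge0 E mulr_ge0 ?subr_ge0 // f'0.
Qed.

Lemma is_derive_exprS n z :
  is_derive z 1 (fun y => y ^+ n.+1) (n.+1%:R * z ^+ n).
Proof.
have di : is_derive z 1 id (1 : R) by exact: is_derive_id.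
elim: n => [|n IH]; first by rewrite mul1r expr0.
apply: is_derive_ext (is_derive_mul di IH) _ _.
  by move=> y; rewrite [RHS]exprS.
by rewrite -[in RHS]natr1 !exprS; ring.
Qed.

(** Integration by monotonicity: both differences between [f] and its bounds have a derivative of
    constant sign. Iterating it gives Taylor expansions with explicit remainders. *)
Lemma integrate_bound (f f' : R -> R) (r k q : R) n : f 0 = 0 ->
  (forall s, 0 <= s <= r -> is_derive s 1 f (f' s)) ->
  (forall s, 0 <= s <= r -> `|f' s - k * s ^+ n| <= q * s ^+ n) ->
  forall s, 0 <= s <= r ->
    `|f s - k / n.+1%:R * s ^+ n.+1| <= q / n.+1%:R * s ^+ n.+1.
Proof.
move=> f0 df fb s sr.
have dX (c : R) t : is_derive t 1 (fun s => c / n.+1%:R * s ^+ n.+1) (c * t ^+ n).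
  apply: is_derive_ext (is_derive_scale (c / n.+1%:R) (is_derive_exprS n t)) _ _.
    by [].
  by rewrite mulrA divfK // pnatr_eq0.
have sI t : 0 <= t <= s -> 0 <= t <= r by lra.
have s0 : 0 <= s by lra.
rewrite ler_norml; apply/andP; split.
- rewrite -subr_ge0 opprK.
  have := @is_derive_nondecr (fun t => f t - k / n.+1%:R * t ^+ n.+1 + q / n.+1%:R * t ^+ n.+1)
   (fun t => f' t - k * t ^+ n + q * t ^+ n) 0 s _ _ s0.
  rewrite f0 !expr0n /= !mulr0 subrr addr0; apply.
  + move=> t /sI tr; exact: is_derive_addf (is_derive_subf (df _ tr) (dX k t)) (dX q t).
  + by move=> t /sI tr; have := fb _ tr; rewrite ler_norml; lra.
- rewrite -subr_ge0.
  have := @is_derive_nondecr (fun t => q / n.+1%:R * t ^+ n.+1 - (f t - k / n.+1%:R * t ^+ n.+1))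
   (fun t => q * t ^+ n - (f' t - k * t ^+ n)) 0 s _ _ s0.
  rewrite f0 !expr0n /= !mulr0 !subrr; apply.
  + move=> t /sI tr; exact: is_derive_subf (dX q t) (is_derive_subf (df _ tr) (dX k t)).
  + by move=> t /sI tr; have := fb _ tr; rewrite ler_norml; lra.
Qed.

Lemma is_derive_divf (f g : R -> R) x a b : g x != 0 -> is_derive x 1 f a ->
  is_derive x 1 g b ->
  is_derive x 1 (fun z => f z / g z) ((a * g x - f x * b) / g x ^+ 2).
Proof.
move=> gx df dg.
apply: is_derive_ext (is_derive_mul df (@is_deriveV _ g x b 1 gx dg)) _ _; first by [].
by rewrite /GRing.scale /=; field.
Qed.

(** * Estimates uniform in e and delta within the radius r of (1/2, 0) *)

Section NearHalf.
Variables (e r : R).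
Hypotheses (r_small : 2 * 1000 * r <= 1) (e_small : `|e - 2^-1| <= r).

Lemma shift_bounds s : 0 <= s <= r ->
  [/\ 4^-1 <= e + s <= 3 / 4, 4^-1 <= e - s <= 3 / 4,
    `|e + s - 2^-1| <= `|e - 2^-1| + s & `|e - s - 2^-1| <= `|e - 2^-1| + s].
Proof.
move=> /andP[s0 sr]; move: e_small; rewrite ler_norml => /andP[h1 h2].
have rs := r_small; split; [lra | lra | |].
- rewrite addrAC; apply: le_trans (ler_normD _ _) _.
  by rewrite (ger0_norm s0).
- rewrite addrAC; apply: le_trans (ler_normB _ _) _.
  by rewrite (ger0_norm s0).
Qed.

Lemma is_derive_shift (f f' : R -> R) s : 0 <= s <= r ->
  (forall z, 0 < z < 1 -> is_derive z 1 f (f' z)) ->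
  is_derive s 1 (fun s => f (e + s)) (f' (e + s)) /\
  is_derive s 1 (fun s => f (e - s)) (- f' (e - s)).
Proof.
move=> sr df; have [hp hm _ _] := shift_bounds sr.
have dc : is_derive s 1 (fun=> e) 0 by exact: is_derive_cst.
have di : is_derive s 1 id (1 : R) by exact: is_derive_id.
have dp : is_derive (e + s) 1 f (f' (e + s)) by apply: (df _ _); lra.
have dm : is_derive (e - s) 1 f (f' (e - s)) by apply: (df _ _); lra.
split.
- apply: is_derive_ext (@is_derive_compf R f (fun s => e + s) _ _ _ dp (is_derive_addf dc di)) _ _.
    by [].
  by rewrite add0r mulr1.
- apply: is_derive_ext (@is_derive_compf R f (fun s => e - s) _ _ _ dm (is_derive_subf dc di)) _ _.
    by [].
  by rewrite sub0r mulrN1.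
Qed.

Lemma is_derive_linear s : is_derive s 1 id (1 : R).
Proof. exact: is_derive_id. Qed.

Lemma So2_diff_bound s : 0 <= s <= r -> `|So2 (e + s) - So2 (e - s)| <= 16 * s.
Proof.
move=> sr.
have dF t : 0 <= t <= r -> is_derive t 1 (fun s => So2 (e + s) - So2 (e - s))
    (So3 (e + t) - - So3 (e - t)).
  move=> tr; have [dp dm] := is_derive_shift tr is_derive_So2.
  exact: is_derive_subf dp dm.
have := @integrate_bound _ _ r 0 16 0 _ dF.
rewrite addr0 subr0 subrr => /(_ erefl) H.
have {}H : forall s, 0 <= s <= r ->
    `|So2 (e + s) - So2 (e - s) - 0 / 1%:R * s ^+ 1| <= 16 / 1%:R * s ^+ 1.
  apply: H => t tr; have [hp hm _ _] := shift_bounds tr.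
  have [_ b1 _ _ _] := So_derivs_bounds hp; have [_ b2 _ _ _] := So_derivs_bounds hm.
  by rewrite mul0r subr0 expr0 mulr1; move: b1 b2; rewrite !ler_norml; lra.
by have := H s sr; rewrite !mul0r subr0 divr1 expr1.
Qed.

Lemma is_derive_rem2 s : 0 <= s <= r ->
  is_derive s 1 (rem2 e) (So2 (e + s) - So2 (e - s) + 2 * s * So3 (e - s)).
Proof.
move=> sr.
have [dp1 dm1] := is_derive_shift sr (@is_derive_So1 R).
have [_ dm2] := is_derive_shift sr is_derive_So2.
apply: is_derive_ext (is_derive_subf (is_derive_subf dp1 dm1)
  (is_derive_mul (is_derive_scale 2 (is_derive_linear s)) dm2)) _ _.
  by [].
by rewrite /=; ring.
Qed.

Lemma rem2_bound s : 0 <= s <= r -> `|rem2 e s| <= 16 * s ^+ 2.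
Proof.
move=> sr.
have := @integrate_bound (rem2 e) _ r 0 32 1 _ is_derive_rem2.
rewrite /rem2 addr0 subr0 subrr mulr0 mul0r subrr => /(_ erefl) H.
have {}H : forall s, 0 <= s <= r ->
    `|rem2 e s - 0 / 2%:R * s ^+ 2| <= 32 / 2%:R * s ^+ 2.
  apply: H => t tr; have [hp hm _ _] := shift_bounds tr.
  have [_ b3 _ _ _] := So_derivs_bounds hm.
  rewrite mul0r subr0 expr1; have t0 : 0 <= t by case/andP: tr.
  apply: le_trans (ler_normD _ _) _.
  have h : `|2 * t * So3 (e - t)| <= 16 * t.
    have t2 : 0 <= 2 * t by lra.
    rewrite normrM (ger0_norm t2); have := ler_wpM2l t2 b3; lra.
  by have := So2_diff_bound tr; lra.
by have := H s sr; rewrite !mul0r subr0; have -> : 32 / 2%:R = 16 :> R by lra.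
Qed.

Definition incr1 s : R := So1 (e + s) - So1 (e - s).
(** Numerator of the derivative of [slope]. In its own derivative the second-order terms cancel, so
    it is O(s^2) and [slope'] stays bounded although [slope] is a quotient 0/0 at [s = 0]. *)
Definition slope_num s : R := s * (So2 (e + s) + So2 (e - s)) - incr1 s.

Lemma is_derive_incr1 s : 0 <= s <= r ->
  is_derive s 1 incr1 (So2 (e + s) + So2 (e - s)).
Proof.
move=> sr; have [dp1 dm1] := is_derive_shift sr (@is_derive_So1 R).
apply: is_derive_ext (is_derive_subf dp1 dm1) _ _; first by [].
by rewrite opprK.
Qed.

Lemma slope_num_bound s : 0 <= s <= r -> `|slope_num s| <= 8 * s ^+ 2.
Proof.
move=> sr.
have dZ t : 0 <= t <= r -> is_derive t 1 slope_num (t * (So3 (e + t) - So3 (e - t))).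
  move=> tr.
  have [dp2 dm2] := is_derive_shift tr is_derive_So2.
  apply: is_derive_ext (is_derive_subf (is_derive_mul (is_derive_linear t)
    (is_derive_addf dp2 dm2)) (is_derive_incr1 tr)) _ _; first by [].
  by rewrite /=; ring.
have := @integrate_bound slope_num _ r 0 16 1 _ dZ.
rewrite /slope_num /incr1 addr0 subr0 subrr mul0r subrr => /(_ erefl) H.
have {}H : forall s, 0 <= s <= r ->
    `|slope_num s - 0 / 2%:R * s ^+ 2| <= 16 / 2%:R * s ^+ 2.
  apply: H => t tr; have [hp hm _ _] := shift_bounds tr.
  have [_ b1 _ _ _] := So_derivs_bounds hp; have [_ b2 _ _ _] := So_derivs_bounds hm.
  rewrite mul0r subr0 expr1; have t0 : 0 <= t by case/andP: tr.
  rewrite normrM (ger0_norm t0) mulrC ler_wpM2r //.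
  by move: b1 b2; rewrite !ler_norml; lra.
by have := H s sr; rewrite !mul0r subr0; have -> : 16 / 2%:R = 8 :> R by lra.
Qed.

Lemma slopeE s : slope e s = incr1 s / (2 * s).
Proof. by []. Qed.

Definition slope' s : R := slope_num s / (2 * s ^+ 2).

Lemma is_derive_slope s : 0 < s -> s <= r -> is_derive s 1 (slope e) (slope' s).
Proof.
move=> s0 sr; have s0r : 0 <= s <= r by rewrite ltW.
have ns : 2 * s != 0 by rewrite gt_eqF // mulr_gt0.
apply: is_derive_ext (@is_derive_divf _ (fun z => 2 * z) _ _ _ ns
  (is_derive_incr1 s0r) (is_derive_scale 2 (is_derive_linear s))) _ _; first by [].
by rewrite /slope' /slope_num; field; rewrite gt_eqF.
Qed.

Lemma slope_bounds s : 0 < s -> s <= r ->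
  `|slope e s - So2 (e - s)| <= 8 * s /\ `|slope' s| <= 4.
Proof.
move=> s0 sr; have s0r : 0 <= s <= r by rewrite ltW.
have s2 : 0 < 2 * s by rewrite mulr_gt0.
have s22 : 0 < 2 * s ^+ 2 by rewrite mulr_gt0 // exprn_gt0.
split.
- have -> : slope e s - So2 (e - s) = rem2 e s / (2 * s).
    by rewrite slopeE /incr1 /rem2; field; rewrite gt_eqF.
  rewrite normrM normfV (gtr0_norm s2) ler_pdivrMr //.
  by apply: le_trans (rem2_bound s0r) _; lra.
- rewrite /slope' normrM normfV (gtr0_norm s22) ler_pdivrMr //.
  by apply: le_trans (slope_num_bound s0r) _; lra.
Qed.

Definition wgt' s : R :=
  - 4 * So2 (e - s) + 4 * s * So3 (e - s) + 4 * slope e s - 4 * (e - s) * slope' s.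

(** The limit at e = 1/2, s = 0 is 4, since [slope] and [So2] both tend to -2. In [wgt'] the terms
    [-4 So2] and [4 slope] nearly cancel, leaving about 32 + 16. *)
Lemma wgt_bounds s : 0 < s -> s <= r -> 1 <= wgt e s /\ `|wgt' s| <= 60.
Proof.
move=> s0 sr; have [b1 b2] := slope_bounds s0 sr; have rs := r_small.
have s0r : 0 <= s <= r by rewrite ltW.
have [hp hm _ _] := shift_bounds s0r.
have [c2 c3 _ _ _] := So_derivs_bounds hm.
move: b1 b2 c3; rewrite !ler_norml => /andP[b1 b1'] /andP[b2 b2'] /andP[c3 c3'].
split.
- have D1 : slope e s <= - 1 by lra.
  have h1 : (e - s) * (slope e s + 1) <= 0 by rewrite mulr_ge0_le0 //; lra.
  have h2 : s * So2 (e - s) <= 0 by rewrite mulr_ge0_le0 //; lra.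
  by rewrite /wgt; lra.
- have s1 : s <= 1 by lra.
  have h1 : `|s * So3 (e - s)| <= 1 * 8.
    by rewrite normrM ler_pM // ler_norml; apply/andP; split; lra.
  have h2 : `|(e - s) * slope' s| <= 1 * 4.
    by rewrite normrM ler_pM // ler_norml; apply/andP; split; lra.
  move: h1 h2; rewrite !ler_norml => /andP[h1 h1'] /andP[h2 h2'].
  by rewrite /wgt'; apply/andP; split; lra.
Qed.

Lemma is_derive_wgt s : 0 < s -> s <= r -> is_derive s 1 (wgt e) (wgt' s).
Proof.
move=> s0 sr; have s0r : 0 <= s <= r by rewrite ltW.
have [_ dm2] := is_derive_shift s0r is_derive_So2.
have dc : is_derive s 1 (fun=> e) 0 by exact: is_derive_cst.
apply: is_derive_ext (is_derive_scale (-1) (is_derive_addf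
  (is_derive_mul (is_derive_scale 4 (is_derive_linear s)) dm2)
  (is_derive_mul (is_derive_scale 4 (is_derive_subf dc (is_derive_linear s)))
    (is_derive_slope s0 sr)))) _ _.
  by move=> z; rewrite /wgt mulN1r.
by rewrite /wgt' /=; ring.
Qed.

(** The term [2 s rem2^2 / wgt] divided by [8 s^3], since [rem2 = 2 s (slope - So2)]. *)
Definition tail s : R := (slope e s - So2 (e - s)) ^+ 2 / wgt e s.

(** With x the squared difference's base, |x| <= 8 s <= 8/2000 and the derivative is at most (24 +
    60) |x|. The bound 3/8 only has to stay below the 2/5 gained from [rem3] in [is_derive_bend]. *)
Lemma is_derive_tail s : 0 < s -> s <= r ->
  exists t', is_derive s 1 tail t' /\ `|t'| <= 3 / 8.
Proof.
move=> s0 sr; have s0r : 0 <= s <= r by rewrite ltW.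
have [w1 w60] := wgt_bounds s0 sr; have [b1 b2] := slope_bounds s0 sr.
have [_ dm2] := is_derive_shift s0r is_derive_So2.
have [_ hm _ _] := shift_bounds s0r; have [_ b3 _ _ _] := So_derivs_bounds hm.
have rs := r_small.
have w0 : wgt e s != 0 by rewrite gt_eqF // (lt_le_trans _ w1).
have dx := is_derive_subf (is_derive_slope s0 sr) dm2.
have dt := @is_derive_divf (fun s => (slope e s - So2 (e - s)) * (slope e s - So2 (e - s)))
  (wgt e) _ _ _ w0 (is_derive_mul dx dx) (is_derive_wgt s0 sr).
eexists; split; first by apply: is_derive_ext dt _ erefl => z; rewrite -expr2.
move: w1 w60 b1 b2 b3 w0; rewrite opprK.
set x := slope e s - So2 (e - s); set w := wgt e s; set w' := wgt' s.
move=> w1 w60 b1 b2 b3 w0.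
have b4 : `|slope' s + So3 (e - s)| <= 12 by apply: le_trans (ler_normD _ _) _; lra.
move: b4; set x' := slope' s + So3 (e - s) => b4.
clearbody x w w' x'; clear dt dx dm2.
have -> : ((x' * x + x * x') * w - x * x * w') / w ^+ 2
    = 2 * x * x' / w - x * x * w' / w / w.
  by field; rewrite w0.
have wV : `|w^-1| <= 1.
  by rewrite normfV invf_le1 ?normr_gt0 // (le_trans w1) // ler_norm.
have xs : `|x| * 2 * 1000 <= 8.
  by apply: le_trans (_ : 8 * (2 * 1000 * r) <= _); lra.
have h1 : `|2 * x * x' / w| <= 24 * `|x|.
  have -> : 2 * x * x' / w = 2 * (x * (x' * w^-1)) by ring.
  rewrite normrM ger0_norm // normrM normrM.
  have : `|x'| * `|w^-1| <= 12 * 1 by rewrite ler_pM.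
  have := normr_ge0 x; nra.
have h2 : `|x * x * w' / w / w| <= 60 * `|x|.
  rewrite !normrM.
  have : `|w'| * `|w^-1| * `|w^-1| <= 60 * 1 * 1 by rewrite !ler_pM ?mulr_ge0.
  have : `|x| <= 1 by lra.
  have := normr_ge0 x; have := normr_ge0 w'; have := normr_ge0 w^-1.
  set X := `|x|; set B := `|w'| * _ * _ => p1 p2 X0 X1 B60.
  have -> : X * X * `|w'| * `|w^-1| * `|w^-1| = X * (X * B) by rewrite /B; ring.
  have : X * B <= 1 * (60 * 1 * 1) by rewrite ler_pM // /B !mulr_ge0.
  by nra.
by apply: le_trans (ler_normB _ _) _; lra.
Qed.

(** Successive derivatives of [rem3] in [s]. The fourth is the first that is nonzero at e = 1/2, s =
    0, with value -16 + 17 * 16 = 256. *)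
Definition rem3'1 s : R := incr1 s - 2 * s * So2 (e - s) + 2 * s ^+ 2 * So3 (e - s).
Definition rem3'2 s : R :=
  So2 (e + s) - So2 (e - s) + 6 * s * So3 (e - s) - 2 * s ^+ 2 * So4 (e - s).
Definition rem3'3 s : R :=
  So3 (e + s) + 7 * So3 (e - s) - 10 * s * So4 (e - s) + 2 * s ^+ 2 * So5 (e - s).
Definition rem3'4 s : R :=
  So4 (e + s) - 17 * So4 (e - s) + 14 * s * So5 (e - s) - 2 * s ^+ 2 * So6 (e - s).

Lemma is_derive_rem3 s : 0 <= s <= r ->
  [/\ is_derive s 1 (rem3 e) (rem3'1 s), is_derive s 1 rem3'1 (rem3'2 s),
    is_derive s 1 rem3'2 (rem3'3 s) & is_derive s 1 rem3'3 (rem3'4 s)].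
Proof.
move=> sr.
have [dp0 dm0] := is_derive_shift sr (@is_derive_So R).
have [dp1 dm1] := is_derive_shift sr (@is_derive_So1 R).
have [dp2 dm2] := is_derive_shift sr is_derive_So2.
have [dp3 dm3] := is_derive_shift sr is_derive_So3.
have [dp4 dm4] := is_derive_shift sr is_derive_So4.
have [dp5 dm5] := is_derive_shift sr is_derive_So5.
have d1 (c : R) := is_derive_scale c (is_derive_linear s).
have d2 := is_derive_scale 2 (is_derive_exprS 1 s).
split.
- apply: is_derive_ext (is_derive_subf (is_derive_subf (is_derive_subf dp0 dm0)
    (is_derive_mul (d1 2) dm1)) (is_derive_mul d2 dm2)) _ _; first by [].
  by rewrite /rem3'1 /incr1 /=; ring.
- apply: is_derive_ext (is_derive_addf (is_derive_subf (is_derive_incr1 sr)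
    (is_derive_mul (d1 2) dm2)) (is_derive_mul d2 dm3)) _ _; first by [].
  by rewrite /rem3'2 /=; ring.
- apply: is_derive_ext (is_derive_subf (is_derive_addf (is_derive_subf dp2 dm2)
    (is_derive_mul (d1 6) dm3)) (is_derive_mul d2 dm4)) _ _; first by [].
  by rewrite /rem3'3 /=; ring.
- apply: is_derive_ext (is_derive_addf (is_derive_subf (is_derive_addf dp3
    (is_derive_scale 7 dm3)) (is_derive_mul (d1 10) dm4)) (is_derive_mul d2 dm5)) _ _;
    first by [].
  by rewrite /rem3'4 /=; ring.
Qed.

Lemma rem3'4_bound d s : 0 <= s <= d -> d <= r ->
  `|rem3'4 s - 256| <= 25 * 1000 * (`|e - 2^-1| + d).
Proof.
move=> /andP[s0 sd] dr; have sr : 0 <= s <= r by rewrite s0 (le_trans sd).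
have [hp hm hp' hm'] := shift_bounds sr.
have [_ _ p4 _ _] := So_derivs_bounds hp.
have [_ _ m4 m5 m6] := So_derivs_bounds hm.
have rs := r_small.
have -> : rem3'4 s - 256 = (So4 (e + s) + 16) - 17 * (So4 (e - s) + 16)
    + s * (14 * So5 (e - s) - 2 * s * So6 (e - s)) by rewrite /rem3'4; ring.
(* 14 * 768 + 2 * 24 * 1024 / 64 is below 12 * 1000, as [s] is below 1/64. *)
have h : `|s * (14 * So5 (e - s) - 2 * s * So6 (e - s))| <= s * (12 * 1000).
  rewrite normrM (ger0_norm s0) ler_wpM2l //.
  move: m5 m6; move: (So5 _) (So6 _) => v5 v6 m5 m6.
  apply: le_trans (ler_normB _ _) _; rewrite !normrM (ger0_norm s0) !normr_nat.
  have : s * `|v6| <= 64^-1 * (24 * 1024) by rewrite ler_pM //; lra.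
  by lra.
have h17 : `|17 * (So4 (e - s) + 16)| <= 17 * `|So4 (e - s) + 16|.
  by rewrite normrM normr_nat.
apply: le_trans (ler_normD _ _) _; apply: le_trans (lerD (ler_normB _ _) (lexx _)) _.
have := normr_ge0 (e - 2^-1); lra.
Qed.

(** Four integrations starting from [rem3'4_bound]. The third derivative equals [8 So3 e] at 0, and
    subtracting its iterated integrals makes each function vanish at 0. *)
Lemma rem3_bounds d : 0 < d -> d <= r ->
  let q := 25 * 1000 * (`|e - 2^-1| + d) in
  `|rem3'1 d - 4 * So3 e * d ^+ 2 - 128 / 3 * d ^+ 3| <= q / 6 * d ^+ 3 /\
  `|rem3 e d - 4 / 3 * So3 e * d ^+ 3 - 32 / 3 * d ^+ 4| <= q / 24 * d ^+ 4.
Proof.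
move=> d0 dr q; have dI s : 0 <= s <= d -> 0 <= s <= r by lra.
have b3 : forall s, 0 <= s <= d ->
    `|(rem3'3 s - 8 * So3 e) - 256 / 1%:R * s ^+ 1| <= q / 1%:R * s ^+ 1.
  apply: (integrate_bound (f' := fun s => rem3'4 s - 0)).
  - by rewrite /rem3'3 addr0 subr0; ring.
  - move=> s /dI sr; have [_ _ _ d4] := is_derive_rem3 sr.
    have dc : is_derive s 1 (fun=> 8 * So3 e) 0 by exact: is_derive_cst.
    exact: is_derive_subf d4 dc.
  - by move=> s sd; rewrite subr0 !expr0 !mulr1; exact: rem3'4_bound.
have b2 : forall s, 0 <= s <= d ->
    `|(rem3'2 s - 8 * So3 e * s) - 256 / 2%:R * s ^+ 2| <= q / 2%:R * s ^+ 2.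
  apply: (integrate_bound (f' := fun s => rem3'3 s - 8 * So3 e * 1)).
  - by rewrite /rem3'2 addr0 subr0; ring.
  - move=> s /dI sr; have [_ _ d3 _] := is_derive_rem3 sr.
    exact: is_derive_subf d3 (is_derive_scale _ (is_derive_linear s)).
  - by move=> s /b3; rewrite mulr1 !divr1.
have b1 : forall s, 0 <= s <= d ->
    `|(rem3'1 s - 4 * So3 e * s ^+ 2) - 256 / 2%:R / 3%:R * s ^+ 3|
      <= q / 2%:R / 3%:R * s ^+ 3.
  apply: (integrate_bound (f' := fun s => rem3'2 s - 4 * So3 e * (2%:R * s ^+ 1))).
  - by rewrite /rem3'1 /incr1 addr0 subr0; ring.
  - move=> s /dI sr; have [_ d2 _ _] := is_derive_rem3 sr.
    exact: is_derive_subf d2 (is_derive_scale _ (is_derive_exprS 1 s)).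
  - move=> s /b2; have -> : 4 * So3 e * (2%:R * s ^+ 1) = 8 * So3 e * s by ring.
    by [].
have b0 : forall s, 0 <= s <= d ->
    `|(rem3 e s - 4 / 3 * So3 e * s ^+ 3) - 256 / 2%:R / 3%:R / 4%:R * s ^+ 4|
      <= q / 2%:R / 3%:R / 4%:R * s ^+ 4.
  apply: (integrate_bound (f' := fun s => rem3'1 s - 4 / 3 * So3 e * (3%:R * s ^+ 2))).
  - by rewrite /rem3 addr0 subr0; ring.
  - move=> s /dI sr; have [d1 _ _ _] := is_derive_rem3 sr.
    exact: is_derive_subf d1 (is_derive_scale _ (is_derive_exprS 2 s)).
  - move=> s /b1; have -> : 4 / 3 * So3 e * (3%:R * s ^+ 2) = 4 * So3 e * s ^+ 2 by field.
    by [].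
have dd : 0 <= d <= d by rewrite ltW /=.
split.
- have := b1 _ dd; have -> : 256 / 2%:R / 3%:R = 128 / 3 :> R by field.
  by have -> : q / 2%:R / 3%:R = q / 6 by field.
- have := b0 _ dd; have -> : 256 / 2%:R / 3%:R / 4%:R = 32 / 3 :> R by field.
  by have -> : q / 2%:R / 3%:R / 4%:R = q / 24 by field.
Qed.

Definition bend s : R := rem3 e s / (8 * s ^+ 3) - tail s.

Lemma curvature_bend s : s != 0 -> curvature e s = - 32 * s ^+ 3 * bend s.
Proof.
move=> s0; rewrite /curvature /bend /tail.
have -> : rem2 e s = 2 * s * (slope e s - So2 (e - s)).
  by rewrite /rem2 /slope; field.
rewrite -[in LHS]/(wgt e s); set w := (wgt e s)^-1.
by rewrite -/w; field.
Qed.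

(** In [s rem3'1 - 3 rem3] the [So3 e] terms cancel, so monotonicity holds on both sides of e = 1/2.
    What remains is at least (32/3 - 7 q / 24) s^4; the radius is chosen to give q <= 25, hence a
    slope of at least 2/5, above the 3/8 of [tail]. *)
Lemma is_derive_bend s : 0 < s -> s <= r ->
  exists k', is_derive s 1 bend k' /\ 0 < k'.
Proof.
move=> s0 sr; have s0r : 0 <= s <= r by rewrite ltW.
have [t' [dt t8]] := is_derive_tail s0 sr.
have [d1 _ _ _] := is_derive_rem3 s0r.
have ns : 8 * s ^+ 3 != 0 by rewrite mulf_neq0 ?expf_neq0 ?gt_eqF.
have dk := is_derive_subf (@is_derive_divf (rem3 e) (fun s => 8 * s ^+ 3) _ _ _ ns d1
  (is_derive_scale 8 (is_derive_exprS 2 s))) dt.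
eexists; split; first exact: dk.
have [b1 b0] := rem3_bounds s0 sr.
move: b1 b0; set q := 25 * 1000 * _ => b1 b0.
have q25 : q <= 25 by rewrite /q; have := r_small; have := e_small; lra.
have s4 : 0 < s ^+ 4 by rewrite exprn_gt0.
have -> : (rem3'1 s * (8 * s ^+ 3) - rem3 e s * (8 * (3%:R * s ^+ 2))) / (8 * s ^+ 3) ^+ 2
    = (s * rem3'1 s - 3 * rem3 e s) / (8 * s ^+ 4) by field; rewrite gt_eqF.
have h : 2 / 5 <= (s * rem3'1 s - 3 * rem3 e s) / (8 * s ^+ 4).
  rewrite ler_pdivlMr; last by lra.
  move: b1 b0; rewrite !ler_norml => /andP[b1 _] /andP[_ b0].
  have := ler_wpM2l (ltW s0) b1.
  have -> : s * (rem3'1 s - 4 * So3 e * s ^+ 2 - 128 / 3 * s ^+ 3)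
    = s * rem3'1 s - 4 * So3 e * s ^+ 3 - 128 / 3 * s ^+ 4 by ring.
  have -> : s * - (q / 6 * s ^+ 3) = - (q / 6 * s ^+ 4) by ring.
  have := ler_wpM2r (ltW s4) q25; lra.
by move: t8; rewrite ler_norml; lra.
Qed.

Lemma bend_incr s t : 0 < s -> s < t -> t <= r -> bend s < bend t.
Proof.
move=> s0 st tr.
have ex x : exists k', 0 < x <= r -> is_derive x 1 bend k' /\ 0 < k'.
  have [/andP[x0 xr]|] := boolP (0 < x <= r); last by exists 0.
  by have [k' kP] := is_derive_bend x0 xr; exists k'.
have [k' kP] := choice ex.
have I z : s <= z <= t -> 0 < z <= r by lra.
have dk z : s <= z <= t -> is_derive z 1 bend (k' z) by move=> /I /kP [].
have k0 z : s <= z <= t -> 0 < k' z by move=> /I /kP [].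
exact: is_derive_incr dk k0 st.
Qed.

(** The error constant collects 25 * 1000 / 192 from [rem3] and 64 from [tail]. *)
Lemma bend_approx s : 0 < s -> s <= r ->
  `|bend s - So3 e / 6 - 4 / 3 * s| <= 200 * (`|e - 2^-1| + s) * s.
Proof.
move=> s0 sr; have s0r : 0 <= s <= r by rewrite ltW.
have [w1 _] := wgt_bounds s0 sr; have [b1 _] := slope_bounds s0 sr.
have [_ b0] := rem3_bounds s0 sr.
move: b0; set q := 25 * 1000 * _ => b0.
have -> : bend s - So3 e / 6 - 4 / 3 * s =
    (rem3 e s - 4 / 3 * So3 e * s ^+ 3 - 32 / 3 * s ^+ 4) / (8 * s ^+ 3) - tail s.
  by rewrite /bend; field; rewrite gt_eqF.
have s3 : 0 < 8 * s ^+ 3 by rewrite mulr_gt0 // exprn_gt0.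
apply: le_trans (ler_normB _ _) _.
have h1 : `|(rem3 e s - 4 / 3 * So3 e * s ^+ 3 - 32 / 3 * s ^+ 4) / (8 * s ^+ 3)|
    <= q / 192 * s.
  rewrite normrM normfV (gtr0_norm s3) ler_pdivrMr //.
  by have -> : q / 192 * s * (8 * s ^+ 3) = q / 24 * s ^+ 4 by field.
have h2 : `|tail s| <= 64 * s * s.
  rewrite /tail normrM normrX.
  have wV : `|(wgt e s)^-1| <= 1.
    by rewrite normfV ger0_norm ?(le_trans _ w1) // invf_le1 // (lt_le_trans _ w1).
  have x2 : `|slope e s - So2 (e - s)| ^+ 2 <= (8 * s) ^+ 2.
    by rewrite lerXn2r // nnegrE //; lra.
  have := ler_pM (exprn_ge0 2 (normr_ge0 _)) (normr_ge0 _) x2 wV; lra.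
have n0 := normr_ge0 (e - 2^-1).
have h3 : 0 <= `|e - 2^-1| * s by rewrite mulr_ge0 // ltW.
have h4 : 0 <= s * s by rewrite mulr_ge0 // ltW.
by move: h1; rewrite /q; lra.
Qed.

(** Exactly, [So3 e = - x q^2] with x = e - 1/2 and q = 1 / (e (1 - e)) = 4 + O(x^2). The error is
    cubic; its constant 180 is absorbed by one factor |x| <= 1/2000. *)
Lemma So3_approx : `|So3 e + 16 * (e - 2^-1)| <= `|e - 2^-1| ^+ 2.
Proof.
have sr0 : 0 <= (0 : R) <= r by rewrite lexx /=; exact: le_trans (normr_ge0 _) e_small.
have [he _ _ _] := shift_bounds sr0; rewrite addr0 in he.
have e0 : e != 0 by rewrite gt_eqF //; lra.
have e1 : 1 - e != 0 by rewrite gt_eqF //; lra.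
pose q := (e * (1 - e))^-1; set x := e - 2^-1.
have qx : q * (4^-1 - x ^+ 2) = 1 by rewrite /q /x; field; rewrite e0 e1.
have -> : So3 e + 16 * x = - (x * (q ^+ 2 - 16)).
  by rewrite /So3 /q /x; field; rewrite e0 e1.
have rs := r_small; have es := e_small; rewrite -/x in es.
have x1 : `|x| * (2 * 1000) <= 1 by lra.
have x0 := normr_ge0 x.
have xx : x ^+ 2 = `|x| ^+ 2 by rewrite real_normK // num_real.
have q0 : 0 < q by rewrite invr_gt0 mulr_gt0 //; lra.
move: qx; rewrite xx normrN normrM; clearbody q x; set y := `|x| in es x1 x0 *.
move=> qx; clearbody y.
have y20 : y ^+ 2 <= 20^-1 by rewrite expr2; nra.
have y0 : 0 <= y ^+ 2 by rewrite exprn_ge0.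
have q5 : q <= 5 by have := ler_wpM2l (ltW q0) y20; lra.
have qy : q - 4 = 4 * (q * y ^+ 2) by lra.
have q4 : 0 <= q - 4 by rewrite qy !mulr_ge0 // ltW.
have qy5 : q - 4 <= 20 * y ^+ 2 by have := ler_wpM2r y0 q5; lra.
have -> : q ^+ 2 - 16 = (q - 4) * (q + 4) by ring.
rewrite ger0_norm ?mulr_ge0 //; last by lra.
have h : (q - 4) * (q + 4) <= 20 * y ^+ 2 * 9 by rewrite ler_pM //; lra.
have := ler_wpM2l x0 h; have := ler_wpM2r y0 x1; lra.
Qed.

Lemma curvature_eq0 s : 0 < s -> s <= r -> curvature e s = 0 -> bend s = 0.
Proof.
move=> s0 sr; have ns : s != 0 by rewrite gt_eqF.
have n0 : - 32 * s ^+ 3 != 0 by rewrite mulf_neq0 ?oppr_eq0 ?pnatr_eq0 // expf_neq0.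
by rewrite curvature_bend // => E; apply: (mulfI n0); rewrite E mulr0.
Qed.

Lemma curvature_inj s t : 0 < s -> s <= r -> 0 < t -> t <= r ->
  curvature e s = 0 -> curvature e t = 0 -> s = t.
Proof.
move=> s0 sr t0 tr /(curvature_eq0 s0 sr) bs /(curvature_eq0 t0 tr) bt.
case: (ltgtP s t) => // [/(bend_incr s0)/(_ tr)|/(bend_incr t0)/(_ sr)].
- by rewrite bs bt ltxx.
- by rewrite bs bt ltxx.
Qed.

(** For e <= 1/2 the leading terms [-(8/3) (e - 1/2)] and [(4/3) s] of [bend] are both nonnegative,
    the second is positive, and the errors are too small to cancel them. *)
Lemma curvature_neq0 s : e <= 2^-1 -> 0 < s -> s <= r -> curvature e s != 0.
Proof.
move=> e2 s0 sr; apply/eqP => /(curvature_eq0 s0 sr) bs.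
have := bend_approx s0 sr; have := So3_approx.
have rs := r_small; have es := e_small.
rewrite bs; have nE : `|e - 2^-1| = 2^-1 - e by rewrite ler0_norm ?subr_le0 //; ring.
rewrite nE in es *; set y := 2^-1 - e in es *.
have y0 : 0 <= y by rewrite /y; lra.
have -> : e - 2^-1 = - y by rewrite /y; ring.
rewrite !ler_norml => /andP[h1 _] /andP[h2 _].
have hy : 2 * 1000 * y <= 1 by lra.
have hs : 2 * 1000 * (y + s) <= 2 by lra.
have h3 := ler_wpM2l y0 hy; have h4 := ler_wpM2l (ltW s0) hs.
by lra.
Qed.

Lemma curvature_root : 2^-1 < e -> 4 * (e - 2^-1) <= r ->
  exists p, [/\ 0 < p, p <= r, curvature e p = 0 &
    `|p - 2 * (e - 2^-1)| <= 4 * 1000 * (e - 2^-1) ^+ 2].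
Proof.
move=> e2 e4; have rs := r_small.
have nE : `|e - 2^-1| = e - 2^-1 by rewrite ger0_norm // subr_ge0 ltW.
have := So3_approx; rewrite nE.
have approx s : 0 < s -> s <= r -> _ := @bend_approx s; rewrite nE in approx.
set y := e - 2^-1 in e4 approx *; have y0 : 0 < y by rewrite subr_gt0.
rewrite ler_norml => /andP[h1 h2].
have hy : 4 * (2 * 1000 * y) <= 1 by lra.
have yy := ler_wpM2l (ltW y0) hy.
(* The leading part [-(8/3) y + (4/3) s] is [-(4/3) y] at [s = y] and [(8/3) y] at [s = 4 y], so the
   root lies between. *)
have by0 : bend y < 0.
  have /approx : 0 < y by []; have yr : y <= r by lra.
  by move=> /(_ yr); rewrite ler_norml => /andP[_ ?]; lra.
have b4y0 : 0 < bend (4 * y).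
  have /approx : 0 < 4 * y by lra.
  by move=> /(_ e4); rewrite ler_norml => /andP[? _]; lra.
have cb : {within `[y, 4 * y], continuous bend}.
  apply: continuous_in_subspaceT => z; rewrite inE /= in_itv /= => zI.
  have [||k' [dk _]] := @is_derive_bend z; [lra | lra |].
  exact: derive_continuous dk.
have y4 : y <= 4 * y by lra.
have b0 : Num.min (bend y) (bend (4 * y)) <= 0 <= Num.max (bend y) (bend (4 * y)).
  by rewrite ge_min le_max (ltW by0) (ltW b4y0) orbT.
have [p pI bp] := IVT y4 cb b0.
move: pI; rewrite in_itv /= => /andP[yp py4].
have p0 : 0 < p by lra.
have pr : p <= r by lra.
exists p; split=> //; first by rewrite curvature_bend ?gt_eqF // bp mulr0.
have := approx p p0 pr; rewrite bp ler_norml => /andP[h3 h4].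
(* The error of [bend_approx] is thus at most 200 * 20 y^2; adding y^2 / 6 from [So3_approx] and
   multiplying by 3/4 stays below 4 * 1000 y^2. *)
have h5 : (y + p) * p <= (5 * y) * (4 * y) by apply: ler_pM; lra.
by rewrite ler_norml; apply/andP; split; lra.
Qed.

End NearHalf.

End CurvatureEstimates.

(** * Existence of critical curves *)

Section CriticalCurves.
Variable R : realType.
Implicit Types (a b c d e s t x z : R).

Lemma smooth1_twice_derivable (f : R -> R) x : smooth1 2 f x -> twice_derivable_near f x.
Proof.
move=> [f' [df [f'' [df' _]]]].
have ndf : \forall z \near x, \forall y \near z, is_derive (y : R) 1 f (f' y).
  exact: nbhs_interior df.
near=> z.
have nz : \forall y \near z, is_derive (y : R) 1 f (f' y) by near: z.
have dz : is_derive (z : R) 1 f (f' z) := nbhs_singleton nz.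
have dz' : is_derive (z : R) 1 f' (f'' z) by near: z.
split; first by case: dz.
have [dd _] : is_derive (z : R) 1 (derive1 f) (f'' z); last exact: dd.
apply: near_eq_is_derive dz'.
by apply: filterS nz => y dy; rewrite (derive1_val dy).
Unshelve. all: by end_near. Qed.

Lemma smooth1X2 k (f : R -> R) x : smooth1 k f x -> smooth1 k (fun z => f z ^+ 2) x.
Proof.
move=> sf; have -> : (fun z => f z ^+ 2) = (fun z => f z * f z).
  by apply/funext => z; rewrite expr2.
exact: smooth1M.
Qed.

Section CriticalCurve.
Variables (e t : R).
Hypotheses (te : t < e ^+ 3) (a_gt0 : 0 < e - sym_gap e t)
  (d_lt1 : e + sym_gap e t < 1) (wgt_neq0 : wgt e (sym_gap e t) != 0).

Local Notation g := (sym_gap e t).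

(* With [sigma = c (1 - c) u ^+ 2], the triangle constraint depends on
   [(c, u, mu)] only through [(sigma, mu)]; this solves it for [mu]. *)
Lemma exists_mu : exists M : R -> R, [/\ M 0 = g,
  \forall s \near (0 : R), M s ^+ 3 - 3 * (e - M s) * s = e ^+ 3 - t
  & smooth1 2 M 0].
Proof.
have g0 := sym_gap_gt0 te; have g3 := sym_gapX3 (ltW te).
pose F (q : R * R) : R := q.2 * (q.2 * q.2) + (- (e ^+ 3 - t)
  + -3 * ((e + -1 * q.2) * q.1)).
have sF : smooth2 2 F (0, g).
  have s1 := smooth2_fst 2 ((0 : R), g); have s2 := smooth2_snd 2 ((0 : R), g).
  exact: (smooth2D (smooth2M s2 (smooth2M s2 s2)) (smooth2D (smooth2_cst 2 _ _)
    (smooth2M (smooth2_cst 2 _ _) (smooth2M (smooth2D (smooth2_cst 2 _ _)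
      (smooth2M (smooth2_cst 2 _ _) s2)) s1)))).
have F0 : F (0, g) = 0 by rewrite /F /= -g3; ring.
have dF : is_derive g 1 (fun z => F (0, z)) (3 * g ^+ 2).
  have dc : is_derive g 1 (fun=> - (e ^+ 3 - t)) 0 by exact: is_derive_cst.
  apply: is_derive_ext (is_derive_addf (is_derive_exprS 2 g) dc) _ _.
    by move=> z; rewrite /F /=; ring.
  by rewrite addr0.
have n0 : 3 * g ^+ 2 != 0 by rewrite mulf_neq0 ?pnatr_eq0 // expf_neq0 // gt_eqF.
have [M [M0 MF sM]] := implicit_function sF F0 dF n0.
exists M; split=> //; apply: filterS MF => s; rewrite /F /= => E.
by apply/eqP; rewrite -subr_eq0 -E; apply/eqP; ring.
Qed.

(** Values of the graphon of the overview for [s = u sqrt(c (1 - c))] and [mu = m]; this scaling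
    removes the square roots from phi. Writing [-1 * _] keeps the terms in the shape of sums and
    products handled by the smoothness lemmas. *)
Definition bip_a (m c u : R) : R := e + (2 * (1 + -1 * c) * u + -1 * ((1 + -1 * c) * c^-1 * m)).
Definition bip_b (m c u : R) : R := e + (-2 * c * u + -1 * (c * (1 + -1 * c)^-1 * m)).
Definition bip_d (m c u : R) : R := e + ((1 + -2 * c) * u + m).

Lemma bip_paramE (m c u : R) : c != 0 -> 1 - c != 0 ->
  bip_edge (bip_a m c u) (bip_b m c u) c (bip_d m c u) = e /\
  bip_triangle (bip_a m c u) (bip_b m c u) c (bip_d m c u)
    = e ^+ 3 - (m ^+ 3 - 3 * (e - m) * (c * (1 - c) * u ^+ 2)).
Proof.
move=> c0 c1; have c1' : 1 + -1 * c != 0 by rewrite mulN1r.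
split; rewrite /bip_edge /bip_triangle /bip_a /bip_b /bip_d; field.
- by rewrite c0 c1'.
- by rewrite c0 c1'.
Qed.

Lemma exists_crit_zero (M : R -> R) : M 0 = g -> smooth1 2 M 0 ->
  exists u : R -> R, let m c := M (c * (1 - c) * u c ^+ 2) in
    [/\ u 2^-1 = 0, smooth1 2 u 2^-1 & \forall c \near (2^-1 : R),
      crit (bip_a (m c) c (u c)) (bip_b (m c) c (u c)) c (bip_d (m c) c (u c)) = 0].
Proof.
move=> M0 sM; have g0 := sym_gap_gt0 te.
have a01 : 0 < e - g < 1 by have := a_gt0; have := d_lt1; lra.
have d01 : 0 < e + g < 1 by have := a_gt0; have := d_lt1; lra.
pose p0 : R * R := (2^-1, 0).
pose m (q : R * R) : R := M (q.1 * (1 + -1 * q.1) * (q.2 * q.2)).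
pose A q := bip_a (m q) q.1 q.2; pose B q := bip_b (m q) q.1 q.2.
pose D q := bip_d (m q) q.1 q.2.
have s1 := smooth2_fst 2 p0; have s2 := smooth2_snd 2 p0.
have sc (k : R) : smooth2 2 (fun=> k) p0 := smooth2_cst 2 k p0.
have s1m := smooth2D (sc 1) (smooth2M (sc (-1)) s1).
have m0 : m p0 = g by rewrite /m /= !mulr0 M0.
have sm : smooth2 2 m p0.
  apply: (@smooth2_comp _ 2 M (fun q => q.1 * (1 + -1 * q.1) * (q.2 * q.2))).
    by rewrite /= !mulr0.
  exact: smooth2M (smooth2M s1 s1m) (smooth2M s2 s2).
have half : (1 + -1 * 2^-1 : R) = 2^-1 by field.
have h2 : (2^-1 : R) != 0 by rewrite invr_eq0 pnatr_eq0.
have s1V : smooth2 2 (fun q => q.1^-1) p0 by apply: smooth2_comp s1; exact: smooth1V.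
have s1mV : smooth2 2 (fun q => (1 + -1 * q.1)^-1) p0.
  by apply: smooth2_comp s1m; apply: smooth1V; rewrite half.
have sA : smooth2 2 A p0.
  exact: smooth2D (sc e) (smooth2D (smooth2M (smooth2M (sc 2) s1m) s2)
    (smooth2M (sc (-1)) (smooth2M (smooth2M s1m s1V) sm))).
have sB : smooth2 2 B p0.
  exact: smooth2D (sc e) (smooth2D (smooth2M (smooth2M (sc (-2)) s1) s2)
    (smooth2M (sc (-1)) (smooth2M (smooth2M s1 s1mV) sm))).
have sD : smooth2 2 D p0.
  exact: smooth2D (sc e) (smooth2D (smooth2M
    (smooth2D (sc 1) (smooth2M (sc (-2)) s1)) s2) sm).
have A0 : A p0 = e - g by rewrite /A /bip_a m0 /=; field.
have B0 : B p0 = e - g by rewrite /B /bip_b m0 /= half; field.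
have D0 : D p0 = e + g by rewrite /D /bip_d m0 /=; field.
have sSA : smooth2 2 (fun q => So1 (A q)) p0.
  by apply: smooth2_comp sA; rewrite A0; exact: smooth1_So1.
have sSB : smooth2 2 (fun q => So1 (B q)) p0.
  by apply: smooth2_comp sB; rewrite B0; exact: smooth1_So1.
have sSD : smooth2 2 (fun q => So1 (D q)) p0.
  by apply: smooth2_comp sD; rewrite D0; exact: smooth1_So1.
pose F q := crit (A q) (B q) q.1 (D q).
have sN (f : R * R -> R) : smooth2 2 f p0 -> smooth2 2 (fun q => - f q) p0.
  move=> sf; have -> : (fun q => - f q) = (fun q => -1 * f q).
    by apply/funext => q; rewrite mulN1r.
  exact: smooth2M.
have s1m' := smooth2D (sc 1) (sN _ s1).
have sF : smooth2 2 F p0.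
  exact: smooth2D (smooth2M (smooth2D sSA (sN _ sSD)) (smooth2D
      (smooth2M (smooth2M s1 sD) (smooth2D sD (sN _ sA)))
      (smooth2M (smooth2M s1m' sB) (smooth2D sB (sN _ sD)))))
    (sN _ (smooth2M (smooth2D sSB (sN _ sSD)) (smooth2D
      (smooth2M (smooth2M s1 sA) (smooth2D sA (sN _ sD)))
      (smooth2M (smooth2M s1m' sD) (smooth2D sD (sN _ sB)))))).
have F0 : F p0 = 0 by rewrite /F A0 B0 D0 /crit /=; field.
have [M' [dM _]] := sM.
(* [m] depends on [u] only through [u^2], so at the symmetric point [u] moves (a, b, d) in the
   direction (1, -1, 0). *)
have dm : is_derive (0 : R) 1 (fun z => m (2^-1, z)) 0.
  have di : is_derive (0 : R) 1 id (1 : R) by exact: is_derive_id.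
  have dq := is_derive_scale (2^-1 * (1 + -1 * 2^-1)) (is_derive_mul di di).
  have dM0 : is_derive (2^-1 * (1 + -1 * 2^-1) * (0 * 0) : R) 1 M (M' 0).
    by rewrite !mulr0; exact: nbhs_singleton dM.
  apply: is_derive_ext (@is_derive_compf R M
    (fun z => 2^-1 * (1 + -1 * 2^-1) * (z * z)) 0 _ _ dM0 dq) _ _; first by [].
  by rewrite /= !mulr0 mul0r addr0 !mulr0.
have di : is_derive (0 : R) 1 id (1 : R) by exact: is_derive_id.
have dc (k : R) : is_derive (0 : R) 1 (fun=> k) 0 by exact: is_derive_cst.
have dA : is_derive (0 : R) 1 (fun z => A (2^-1, z)) 1.
  apply: is_derive_ext (is_derive_addf (dc e) (is_derive_addf
    (is_derive_scale (2 * (1 + -1 * 2^-1)) di) (is_derive_scale (-1)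
      (is_derive_scale ((1 + -1 * 2^-1) * 2^-1^-1) dm)))) _ _; first by [].
  by field.
have dB : is_derive (0 : R) 1 (fun z => B (2^-1, z)) (-1).
  apply: is_derive_ext (is_derive_addf (dc e) (is_derive_addf
    (is_derive_scale (-2 * 2^-1) di) (is_derive_scale (-1)
      (is_derive_scale (2^-1 * (1 + -1 * 2^-1)^-1) dm)))) _ _; first by [].
  by rewrite half; field.
have dD : is_derive (0 : R) 1 (fun z => D (2^-1, z)) 0.
  apply: is_derive_ext (is_derive_addf (dc e) (is_derive_addf
    (is_derive_scale (1 + -2 * 2^-1) di) dm)) _ _; first by [].
  by field.
have dF := @is_derive_crit R (fun z => A (2^-1, z)) (fun z => B (2^-1, z))
  (fun=> 2^-1) (fun z => D (2^-1, z)) 0 _ _ _ _ _ _ a01 d01 A0 B0 erefl D0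
  dA dB (dc 2^-1) dD.
(* The derivative equals [- g * wgt e g]; here the nondegeneracy hypothesis enters. *)
have n0 : (e + g - (e - g)) ^+ 2 / 2 * So2 (e - g) * (1 - -1)
    + (So1 (e - g) - So1 (e + g)) * (2 * 0 * ((e + g) ^+ 2 - (e - g) ^+ 2)
      - (e - g) * (1 - -1)) != 0.
  suff -> : (e + g - (e - g)) ^+ 2 / 2 * So2 (e - g) * (1 - -1)
    + (So1 (e - g) - So1 (e + g)) * (2 * 0 * ((e + g) ^+ 2 - (e - g) ^+ 2)
      - (e - g) * (1 - -1)) = - g * wgt e g.
    by apply: mulf_neq0 => //; rewrite oppr_eq0 gt_eqF.
  by rewrite /wgt /slope; field; rewrite gt_eqF.
have [u [u0 uF su]] := implicit_function sF F0 dF n0.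
exists u; split=> //; apply: filterS uF => c.
by rewrite /F /A /B /D /m /= !mulN1r -expr2.
Qed.

Lemma exists_critical_curve : exists fa fb fd : R -> R, critical_curve e t fa fb fd.
Proof.
have g0 := sym_gap_gt0 te.
have a01 : 0 < e - g < 1 by have := a_gt0; have := d_lt1; lra.
have d01 : 0 < e + g < 1 by have := a_gt0; have := d_lt1; lra.
have [M [M0 ME sM]] := exists_mu.
have [u [u0 su uE]] := exists_crit_zero M0 sM.
have h2 : (2^-1 : R) != 0 by rewrite invr_eq0 pnatr_eq0.
have half : (1 + -1 * 2^-1 : R) = 2^-1 by field.
pose s (c : R) : R := c * (1 - c) * u c ^+ 2.
pose m c := M (s c).
have sid : smooth1 2 (fun c : R => c) 2^-1 := smooth1_id 2 2^-1.
have sc (k : R) : smooth1 2 (fun=> k) (2^-1 : R) := smooth1_cst 2 k 2^-1.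
have sN (f : R -> R) : smooth1 2 f 2^-1 -> smooth1 2 (fun z => - f z) 2^-1.
  move=> sf; have -> : (fun q => - f q) = (fun q => -1 * f q).
    by apply/funext => q; rewrite mulN1r.
  exact: smooth1M.
have ss : smooth1 2 s 2^-1.
  have ss1 := smooth1M sid (smooth1D (sc 1) (sN _ sid)).
  have ss2 := smooth1X2 su.
  exact: (smooth1M ss1 ss2).
have s0 : s 2^-1 = 0 by rewrite /s u0 expr0n /= mulr0.
have sm : smooth1 2 m 2^-1 by apply: smooth1_comp ss; rewrite s0.
have m0 : m 2^-1 = g by rewrite /m s0.
have s1m := smooth1D (sc 1) (smooth1M (sc (-1)) sid).
have s1V : smooth1 2 (fun c : R => c^-1) 2^-1 by exact: smooth1V.
have s1mV : smooth1 2 (fun c : R => (1 + -1 * c)^-1) 2^-1.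
  by apply: smooth1_comp s1m; apply: smooth1V; rewrite half.
pose fa c := bip_a (m c) c (u c); pose fb c := bip_b (m c) c (u c).
pose fd c := bip_d (m c) c (u c).
have sa : smooth1 2 fa 2^-1.
  exact: smooth1D (sc e) (smooth1D (smooth1M (smooth1M (sc 2) s1m) su)
    (smooth1M (sc (-1)) (smooth1M (smooth1M s1m s1V) sm))).
have sb : smooth1 2 fb 2^-1.
  exact: smooth1D (sc e) (smooth1D (smooth1M (smooth1M (sc (-2)) sid) su)
    (smooth1M (sc (-1)) (smooth1M (smooth1M sid s1mV) sm))).
have sd : smooth1 2 fd 2^-1.
  exact: smooth1D (sc e) (smooth1D (smooth1M
    (smooth1D (sc 1) (smooth1M (sc (-2)) sid)) su) sm).
have a0 : fa 2^-1 = e - g by rewrite /fa /bip_a m0 u0; field.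
have b0 : fb 2^-1 = e - g by rewrite /fb /bip_b m0 u0 half; field.
have d0 : fd 2^-1 = e + g by rewrite /fd /bip_d m0 u0; field.
exists fa, fb, fd; split.
- by [].
- by split; exact: smooth1_twice_derivable.
have na : \forall c \near (2^-1 : R), 0 < fa c < 1.
  by apply: near01_comp (smooth1_continuous sa) _; rewrite a0.
have nb : \forall c \near (2^-1 : R), 0 < fb c < 1.
  by apply: near01_comp (smooth1_continuous sb) _; rewrite b0.
have nd : \forall c \near (2^-1 : R), 0 < fd c < 1.
  by apply: near01_comp (smooth1_continuous sd) _; rewrite d0.
have nc : \forall c \near (2^-1 : R), 0 < c < 1 by apply: near01; lra.
(* The coefficient that must be nonzero to recover criticality from [crit = 0]; it is [2 g^2] at the
   symmetric point. *)
pose X c := c * fa c * (fa c - fd c) + (1 - c) * fd c * (fd c - fb c).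
have sX : smooth1 2 X 2^-1.
  exact: smooth1D (smooth1M (smooth1M sid sa) (smooth1D sa (sN _ sd)))
    (smooth1M (smooth1M (smooth1D (sc 1) (sN _ sid)) sd) (smooth1D sd (sN _ sb))).
have nX : \forall c \near (2^-1 : R), 0 < X c.
  apply: near_continuous_gt (smooth1_continuous sX) _.
  have -> : X 2^-1 = 2 * g ^+ 2 by rewrite /X a0 b0 d0; field.
  by rewrite mulr_gt0 // exprn_gt0.
have nM : \forall c \near (2^-1 : R), m c ^+ 3 - 3 * (e - m c) * s c = e ^+ 3 - t.
  by have cs := smooth1_continuous ss; rewrite /prop_for /continuous_at s0 in cs; exact: cs ME.
near=> c.
have ca : 0 < fa c < 1 by near: c.
have cb : 0 < fb c < 1 by near: c.
have cd : 0 < fd c < 1 by near: c.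
have c01 : 0 < c < 1 by near: c.
have c0 : c != 0 by rewrite gt_eqF //; lra.
have c1 : 1 - c != 0 by rewrite gt_eqF //; lra.
have [E T] := bip_paramE (m c) (u c) c0 c1.
split.
- by split; rewrite /= in_itv /=; lra.
- exact: E.
- rewrite T; have -> : m c ^+ 3 - 3 * (e - m c) * (c * (1 - c) * u c ^+ 2) = e ^+ 3 - t.
    by near: c.
  by ring.
- apply: crit_constrained_critical => //; last by near: c.
  by rewrite gt_eqF //; near: c.
Unshelve. all: by end_near. Qed.

End CriticalCurve.

End CriticalCurves.

(** * The phase boundary *)

Theorem theorem4p1 (R : realType)
  (maximizers_bipodal :
    \forall e \near (2^-1 : R) & t \near (8^-1 : R), t < e ^+ 3 ->
      forall g : R * R -> R, entropy_maximizing e t g -> is_bipodal g) :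
  exists f : R -> R,
    (\forall e \near (2^-1 : R) & t \near (8^-1 : R), t < e ^+ 3 ->
      (phase_boundary e t <-> t = f e)) /\
    (fun e : R => f e - (e ^+ 3 - 8 * (e - 2^-1) ^+ 3))
      =O_ (2^-1 : R) (fun e : R => (e - 2^-1) ^+ 4).
Proof.
pose r : R := (2 * 1000)^-1.
have K0 : 0 < 2 * 1000 :> R by lra.
have r0 : 0 < r by rewrite invr_gt0.
have rs : 2 * 1000 * r <= 1 by rewrite /r (mulfV (lt0r_neq0 K0)).
clearbody r; clear K0.
have dist_e (e : R) : `|e - 2^-1| < r / 4 -> `|e - 2^-1| <= r by lra.
(* The distance r/4 provides [4 * (e - 1/2) <= r], the room needed to bracket the root. *)
have ex (e : R) : exists p, 2^-1 < e -> `|e - 2^-1| < r / 4 ->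
    [/\ 0 < p, p <= r, curvature e p = 0 &
      `|p - 2 * (e - 2^-1)| <= 4 * 1000 * (e - 2^-1) ^+ 2].
  have [e2|] := boolP (2^-1 < e); last by exists 0.
  have [er|] := boolP (`|e - 2^-1| < r / 4); last by exists 0.
  have e4 : 4 * (e - 2^-1) <= r by have := ler_norm (e - 2^-1); lra.
  have [p pP] := curvature_root rs (dist_e _ er) e2 e4.
  by exists p.
have [psi psiP] := choice ex.
(* For e <= 1/2 the boundary is empty. The cubic itself is then at least e^3, so no [t < e^3] equals
   it, and the error term is 0. *)
pose f (e : R) : R :=
  if 2^-1 < e then e ^+ 3 - psi e ^+ 3 else e ^+ 3 - 8 * (e - 2^-1) ^+ 3.
have near_e : \forall e \near (2^-1 : R), `|e - 2^-1| < r / 4.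
  by apply: near_dist_lt; rewrite subrr normr0; lra.
exists f; split; last first.
  have K0 : 0 < 120 * 1000 :> R by lra.
  (* With y = e - 1/2, p^3 - (2 y)^3 is (p - 2 y) times a quadratic form that is at most (16 + 8 +
     4) y^2 once p <= 4 y; and 4 * 1000 * 28 is below 120 * 1000. *)
  apply/eqO_exP; exists (120 * 1000); first exact: K0.
  apply: filterS near_e => e er; rewrite /f.
  case: ifPn => [e2|_]; last first.
    by rewrite subrr normr0; exact: mulr_ge0 (ltW K0) (normr_ge0 _).
  have [p0 pr _ pe] := psiP e e2 er.
  have y0 : 0 < e - 2^-1 by rewrite subr_gt0.
  have y1 : 4 * 1000 * (e - 2^-1) <= 2.
    by have := ler_norm (e - 2^-1); lra.
  move: p0 pe; set p := psi e; set y := e - 2^-1 in y0 y1 *; move=> p0 pe.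
  have -> : e ^+ 3 - p ^+ 3 - (e ^+ 3 - 8 * y ^+ 3)
    = - ((p - 2 * y) * (p ^+ 2 + 2 * p * y + 4 * y ^+ 2)) by ring.
  have p4 : p <= 4 * y.
    have h := ler_wpM2l (ltW y0) y1.
    by move: pe; rewrite ler_norml => /andP[_ ?]; lra.
  have q28 : p ^+ 2 + 2 * p * y + 4 * y ^+ 2 <= 28 * y ^+ 2.
    have h1 := ler_pM (ltW p0) (ltW p0) p4 p4.
    have h2 := ler_pM (ltW p0) (ltW y0) p4 (lexx y).
    by lra.
  have q0 : 0 <= p ^+ 2 + 2 * p * y + 4 * y ^+ 2.
    have h1 : 0 <= p * p by rewrite mulr_ge0 // ltW.
    have h2 : 0 <= p * y by rewrite mulr_ge0 // ltW.
    have h3 : 0 <= y * y by rewrite mulr_ge0 // ltW.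
    by lra.
  have y4 : 0 <= y ^+ 4 by rewrite exprn_ge0 // ltW.
  rewrite normrN normrM (ger0_norm q0) (ger0_norm y4).
  have h := ler_pM (normr_ge0 _) q0 pe q28.
  by clear pe q28; lra.
(* Each of e^3 and t is kept within r^3 / 2 of 1/8 on the relevant side, so that delta^3 = e^3 - t <
   r^3. *)
have near_e3 : \forall e \near (2^-1 : R), e ^+ 3 < 8^-1 + r ^+ 3 / 2.
  apply: (@near_continuous_lt _ _ (fun e : R => e ^+ 3)).
    exact: derive_continuous (is_derive_exprS 2 _).
  by have := exprn_gt0 3 r0; lra.
have near_t : \forall t \near (8^-1 : R), 8^-1 - r ^+ 3 / 2 < t.
  apply: (@near_continuous_gt _ _ id); first exact: cvg_id.
  by have := exprn_gt0 3 r0; lra.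
exists ([set e : R | `|e - 2^-1| < r / 4 /\ e ^+ 3 < 8^-1 + r ^+ 3 / 2],
        [set t : R | 8^-1 - r ^+ 3 / 2 < t]).
  by split => //=; apply: filterS2 near_e near_e3 => e; split.
move=> [e t] [/= [er e3] tr] te.
have d0 := sym_gap_gt0 te; have d3 := sym_gapX3 (ltW te).
set d := sym_gap e t in d0 d3.
have dr : d <= r.
  rewrite leNgt; apply/negP => rd.
  have : r ^+ 3 < d ^+ 3 by rewrite ltrXn2r // ltW.
  by lra.
have er' := dist_e _ er.
have s0r : 0 <= d <= r by rewrite ltW.
have [hp hm _ _] := shift_bounds rs er' s0r.
have a0 : 0 < e - d by lra.
have d1 : e + d < 1 by lra.
have [w1 _] := wgt_bounds rs er' d0 dr.
have w0 : wgt e d != 0 by rewrite gt_eqF // (lt_le_trans _ w1).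
have curv fa fb fd := @critical_curve_curvature R e t fa fb fd te a0 d1 w0.
have boundaryE : phase_boundary e t <-> curvature e d = 0.
  split=> [[_ [fa [fb [fd [cc <-]]]]]|cd]; first by rewrite (curv _ _ _ cc).
  split=> //; have [fa [fb [fd cc]]] := exists_critical_curve te a0 d1 w0.
  by exists fa, fb, fd; split=> //; rewrite (curv _ _ _ cc).
apply: (iff_trans boundaryE); rewrite /f; case: ifPn => [e2|].
  have [p0 pr cp _] := psiP e e2 er; split=> [cd|tE].
    have <- : d = psi e by exact: (curvature_inj rs er').
    by rewrite d3; ring.
  suff -> : d = psi e by [].
  apply/eqP; rewrite -(@eqrXn2 _ 3) ?ltW // d3 tE; apply/eqP; ring.
rewrite -leNgt => e2; split=> [cd|tE].
  by have := curvature_neq0 rs er' e2 d0 dr; rewrite cd eqxx.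
(* Here [f e >= e^3], which contradicts [t < e^3]. *)
exfalso; move: te; rewrite {1}tE ltNge => /negP; apply.
rewrite lerBrDl gerDr.
have : 0 <= (2^-1 - e) ^+ 3 by rewrite exprn_ge0 // subr_ge0.
have -> : (2^-1 - e) ^+ 3 = - (e - 2^-1) ^+ 3 by ring.
by lra.
Qed.
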